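(* Let $n\ge 1$, let $\gamma$ be the standard Gaussian probability measure on $\mathbb{R}^n$, and for $f\in C^1_{\mathrm{poly}}(\mathbb{R}^n)$ write $\overline f=\int_{\mathbb{R}^n} f(y)\,\gamma(y)\,dy$. There exist constants $C_1$, $C_2(p)$ (for each real $p>1/2$), and $C_3$ such that for all $f\in C^1_{\mathrm{poly}}(\mathbb{R}^n)$ the following inequalities hold: $$ \left\|f-\overline f\right\|_{L_{(\exp_2)_*}(\gamma)}\le C_1\,\big\|\,|\nabla f|\,\big\|_{L_{(\exp_2)_*}(\gamma)} , $$ $$ \left\|f-\overline f\right\|_{L^{2p}(\gamma)}\le C_2(p)\,\big\|\,|\nabla f|\,\big\|_{L^{2p}(\gamma)} ,\qquad p>1/2 , $$ $$ \left\|f-\overline f\right\|_{L_{(\cosh-1)}(\gamma)}\le C_3\,\big\|\,|\nabla f|\,\big\|_{L_{\mathrm{gauss}_2}(\gamma)} . $$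
   Context: The standard Gaussian density is $\gamma(x)=(2\pi)^{-n/2}\exp(-|x|^2/2)$, $x\in\mathbb{R}^n$, with $|\cdot|$ the Euclidean norm; the same symbol denotes the probability measure with this density. $C^1_{\mathrm{poly}}(\mathbb{R}^n)$ is the vector space of continuously differentiable functions $f\colon\mathbb{R}^n\to\mathbb{R}$ such that $f$ and all its first-order partial derivatives are bounded in absolute value by a polynomial. For a Young function $\Phi\colon[0,\infty)\to[0,\infty)$ and a probability measure $\mu$, the Luxemburg norm of a measurable function $f$ in the Orlicz space $L_\Phi(\mu)$ is $$\|f\|_{L_\Phi(\mu)}=\inf\Big\{\alpha>0 : \int\Phi(\alpha^{-1}|f|)\,d\mu\le 1\Big\},$$ with value $+\infty$ if no such $\alpha$ exists (i.e. if $f\notin L_\Phi(\mu)$), in which case an inequality having this norm on its right-hand side is trivially true. The Young functions used are, for $x,y\ge 0$: $(\exp_2)_*(y)=(1+y)\log(1+y)-y$ (the convex conjugate of $\exp_2(x)=e^x-1-x$); $(\cosh-1)(x)=\cosh x-1$; $\mathrm{gauss}_2(x)=\exp\left(\tfrac12x^2\right)-1$. $L^{2p}(\gamma)$ is the usual Lebesgue space with its usual norm. *)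

(* Defs.v *)
From HB Require Import structures.
From mathcomp Require Import all_boot all_order all_algebra.
From mathcomp Require Import all_classical all_reals all_analysis.
From mathcomp Require Import measurable_realfun.
From mathcomp Require mpoly.

Set Implicit Arguments.
Unset Strict Implicit.
Unset Printing Implicit Defensive.
Import Order.TTheory GRing.Theory Num.Def Num.Theory.
Import numFieldNormedType.Exports.

Local Open Scope classical_set_scope.
Local Open Scope ring_scope.

Definition measure_rV_display : measure_display.
Proof. exact: (measure_tuple_display default_measure_display). Qed.

(* 'rV[R]_n carries the sigma-algebra generated by its n coordinates, i.e. the
   product Borel sigma-algebra, which is the Borel sigma-algebra of R^n. *)
Section measurable_rV.
Variables (R : realType) (n : nat).

Definition rV_coord (i : 'I_n) (x : 'rV[R]_n) : measurableTypeR R := x ord0 i.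

Let rV_set0 : g_sigma_preimage rV_coord set0.
Proof. exact: sigma_algebra0. Qed.

Let rV_setC A : g_sigma_preimage rV_coord A -> g_sigma_preimage rV_coord (~` A).
Proof. exact: sigma_algebraC. Qed.

Let rV_bigcup (F : _^nat) : (forall i, g_sigma_preimage rV_coord (F i)) ->
  g_sigma_preimage rV_coord (\bigcup_i (F i)).
Proof. exact: sigma_algebra_bigcup. Qed.

HB.instance Definition _ := @isMeasurable.Build measure_rV_display
  'rV[R]_n (g_sigma_preimage rV_coord) rV_set0 rV_setC rV_bigcup.

Lemma measurable_rV_coord (i : 'I_n) : measurable_fun [set: 'rV[R]_n] (rV_coord i).
Proof.
move=> _ Y mY; rewrite setTI; apply: sub_sigma_algebra => /=.
rewrite -bigcup_seq/=; exists i => /=; first by rewrite mem_index_enum.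
by exists Y => //; rewrite setTI.
Qed.

Lemma measurable_fun_rVP d (T : measurableType d) (f : T -> 'rV[R]_n) :
  (forall i, measurable_fun [set: T] (rV_coord i \o f)) ->
  measurable_fun [set: T] f.
Proof.
move=> mf.
have H : g_sigma_preimage (fun i => rV_coord i \o f) `<=` measurable.
  apply: smallest_sub; first exact: sigma_algebra_measurable.
  rewrite -bigcup_seq; apply: bigcup_sub => i _.
  by move=> A [B mB <-]; exact: mf.
rewrite g_sigma_preimage_comp in H.
by move=> _ A mA; apply: H; exists A.
Qed.

End measurable_rV.


Section lebesgue_rV.
Variable R : realType.

Definition cons_rV n (p : measurableTypeR R * 'rV[R]_n) : 'rV[R]_n.+1 :=
  row_mx (p.1 : R)%:M p.2.

Lemma cons_rV0 n p : @cons_rV n p ord0 ord0 = p.1.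
Proof.
by rewrite /cons_rV mxE; case: splitP => // j _; rewrite mxE [j]ord1 eqxx mulr1n.
Qed.

Lemma cons_rVS n p i : @cons_rV n p ord0 (lift ord0 i) = p.2 ord0 i.
Proof.
rewrite /cons_rV mxE; case: splitP => [[[]//] | j /= [ij]].
by congr (p.2 _ _); exact/val_inj.
Qed.

Lemma measurable_cons_rV n : measurable_fun [set: _] (@cons_rV n).
Proof.
apply: measurable_fun_rVP => i; case: (unliftP ord0 i) => [j|] ->.
- rewrite (_ : _ \o _ = rV_coord j \o snd); last first.
    by apply/funext => p /=; rewrite /rV_coord cons_rVS.
  by apply: measurableT_comp => //; exact: measurable_rV_coord.
- rewrite (_ : _ \o _ = fst)//.
  by apply/funext => p /=; rewrite /rV_coord cons_rV0.
Qed.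

Let behead_rV n (x : 'rV[R]_n.+1) : measurableTypeR R * 'rV[R]_n :=
  (x ord0 ord0, \row_j x ord0 (lift ord0 j)).

Let behead_rVK n : cancel (@cons_rV n) (@behead_rV n).
Proof.
move=> p; rewrite /behead_rV cons_rV0 [RHS]surjective_pairing; congr (_, _).
by apply/rowP => j; rewrite mxE cons_rVS.
Qed.

Let measurable_behead_rV n : measurable_fun [set: _] (@behead_rV n).
Proof.
apply: measurable_fun_pair; first exact: measurable_rV_coord.
apply: measurable_fun_rVP => i.
rewrite (_ : _ \o _ = rV_coord (lift ord0 i)); first exact: measurable_rV_coord.
by apply/funext => x /=; rewrite /rV_coord mxE.
Qed.

Local Open Scope ereal_scope.

(* Lebesgue measure on R^n as the n-fold product of the Lebesgue measure on R. *)
Fixpoint lebesgue_rV (n : nat) : set 'rV[R]_n -> \bar R :=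
  match n with
  | 0 => \d_(0%R : 'rV[R]_0)
  | n'.+1 => pushforward (lebesgue_measure \x @lebesgue_rV n') (@cons_rV n')
  end.
Arguments lebesgue_rV : clear implicits.

Let lebesgue_rV_bundle n : exists m : {sigma_finite_measure set 'rV[R]_n -> \bar R},
  lebesgue_rV n = m.
Proof.
elim: n => [|n [m mE]]; first by exists (\d_(0%R : 'rV[R]_0)).
(* The canonical sigma-finite structure on [_ \x _] expects subprobability
   factors, hence sigma-finiteness of the product is rebuilt here. *)
pose p : {measure set (measurableTypeR R * 'rV[R]_n)%type -> \bar R} := (lebesgue_measure \x m).
pose q : {measure set 'rV[R]_n.+1 -> \bar R} :=
  measure_function_pushforward__canonical__measure_function_Measure p
    (@measurable_cons_rV n).
have qE : lebesgue_rV n.+1 = q by rewrite /= mE.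
have sq : sigma_finite setT q.
  have [F FT Foo] : sigma_finite setT p.
    have /sigma_finiteP[F [TF ndF Foo]] :=
      sigma_finiteT (@lebesgue_measure R : {sigma_finite_measure set _ -> \bar R}).
    have /sigma_finiteP[G [TG ndG Goo]] := sigma_finiteT m.
    exists (fun k => F k `*` G k).
      rewrite -setXTT TF TG predeqE => -[x y]; split.
        move=> [/= [i _ Fix] [j _ Gjy]]; exists (maxn i j) => //; split.
        - by move: x Fix; exact/subsetPset/ndF/leq_maxl.
        - by move: y Gjy; exact/subsetPset/ndG/leq_maxr.
      by move=> [i _ []/= ? ?]; split; exists i.
    move=> k; have [? ?] := Foo k; have [? ?] := Goo k.
    split; first exact: measurableX.
    by rewrite /p /= product_measure1E// lte_mul_pinfty// ge0_fin_numE.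
  exists (fun k => @behead_rV n @^-1` F k).
    by rewrite -preimage_bigcup -FT preimage_setT.
  move=> k; have [mF Fk] := Foo k; split.
    by rewrite -[X in measurable X]setTI; exact: measurable_behead_rV.
  rewrite /q /= /pushforward -comp_preimage.
  rewrite (_ : _ \o _ = id) ?preimage_id//.
  by apply/funext => x; exact: behead_rVK.
pose mix := Measure_isSigmaFinite.Build _ _ _ (q : set _ -> \bar R) sq.
pose q' : {sigma_finite_measure set 'rV[R]_n.+1 -> \bar R} :=
  HB.pack (q : set _ -> \bar R) (Measure.on q) mix.
by exists q'.
Qed.

Let lebesgue_rV_set0 n : lebesgue_rV n set0 = 0.
Proof. by have [m ->] := lebesgue_rV_bundle n; rewrite measure0. Qed.

Let lebesgue_rV_ge0 n A : 0 <= lebesgue_rV n A.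
Proof. by have [m ->] := lebesgue_rV_bundle n; exact: measure_ge0. Qed.

Let lebesgue_rV_semi_sigma_additive n : semi_sigma_additive (lebesgue_rV n).
Proof.
by have [m ->] := lebesgue_rV_bundle n; exact: measure_semi_sigma_additive.
Qed.

HB.instance Definition _ n := isMeasure.Build _ _ _ (lebesgue_rV n)
  (@lebesgue_rV_set0 n) (@lebesgue_rV_ge0 n)
  (@lebesgue_rV_semi_sigma_additive n).

Let lebesgue_rV_sigma_finite n : sigma_finite setT (lebesgue_rV n).
Proof. by have [m ->] := lebesgue_rV_bundle n; exact: sigma_finiteT. Qed.

HB.instance Definition _ n := Measure_isSigmaFinite.Build _ _ _ (lebesgue_rV n)
  (@lebesgue_rV_sigma_finite n).

End lebesgue_rV.
Arguments lebesgue_rV : clear implicits.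

Section euclidean.
Variables (R : realType) (n : nat).

(* The library norm on 'rV[R]_n is the maximum norm. *)
Definition enorm (x : 'rV[R]_n) : R := Num.sqrt (\sum_(i < n) x ord0 i ^+ 2).

Definition grad (f : 'rV[R]_n -> R) (x : 'rV[R]_n) : 'rV[R]_n :=
  \row_(i < n) 'D_(delta_mx ord0 i) f x.

Definition poly_bounded (g : 'rV[R]_n -> R) : Prop :=
  exists P : mpoly.mpoly n R, forall x, `|g x| <= mpoly.meval (x ord0) P.

(* [differentiable] and continuity do not depend on the choice of the norm. *)
Definition C1poly (f : 'rV[R]_n -> R) : Prop :=
  [/\ forall x, differentiable f x,
      forall i : 'I_n, continuous ('D_(delta_mx ord0 i) f),
      poly_bounded f &
      forall i : 'I_n, poly_bounded ('D_(delta_mx ord0 i) f)].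

End euclidean.

Section gaussian.
Variable R : realType.

Definition gauss_pdf n (x : 'rV[R]_n) : R :=
  (2 * pi) `^ (- (n%:R / 2)) * expR (- (enorm x ^+ 2 / 2)).

Definition gaussian n (A : set 'rV[R]_n) : \bar R :=
  (\int[lebesgue_rV R n]_(x in A) (gauss_pdf x)%:E)%E.
Arguments gaussian : clear implicits.

Lemma gauss_pdf_ge0 n (x : 'rV[R]_n) : 0 <= gauss_pdf x.
Proof. by rewrite mulr_ge0 ?powR_ge0 ?expR_ge0. Qed.

Lemma measurable_enorm_sq n :
  measurable_fun [set: 'rV[R]_n] (fun x => enorm x ^+ 2 : measurableTypeR R).
Proof.
rewrite (_ : (fun _ => _) = fun x => \sum_(i < n) rV_coord i x ^+ 2).
  apply: measurable_sum => i; apply: measurable_funX; exact: measurable_rV_coord.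
by apply/funext => x; rewrite /enorm sqr_sqrtr// sumr_ge0// => i _; exact: sqr_ge0.
Qed.

Lemma measurable_gauss_pdf n : measurable_fun [set: 'rV[R]_n] (@gauss_pdf n).
Proof.
apply: measurable_funM => //; apply: measurableT_comp => //.
apply: measurableT_comp => //; apply: measurable_funM => //.
exact: measurable_enorm_sq.
Qed.

Lemma gauss_pdf_cons n (p : R * 'rV[R]_n) :
  gauss_pdf (cons_rV p) = normal_pdf 0 1 p.1 * gauss_pdf p.2.
Proof.
have pi2 : 0 < 2 * pi :> R by rewrite mulr_gt0 ?pi_gt0.
rewrite normal_pdfE ?oner_eq0// /normal_peak /normal_fun /gauss_pdf.
rewrite mulrACA -expRD; congr (_ * expR _).
  have -> : - (n.+1%:R / 2) = - (n%:R / 2) - 2^-1 :> R.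
    by rewrite -[n.+1]addn1 natrD (mulrDl n%:R) mul1r opprD.
  rewrite powRD ?(gt_eqF pi2) ?implybT// mulrC; congr (_ * _).
  have -> : 1 ^+ 2 * pi *+ 2 = 2 * pi :> R by rewrite expr1n mul1r mulr_natl.
  by rewrite powRN powR12_sqrt ?ltW.
rewrite /enorm !sqr_sqrtr ?sumr_ge0// => [|i _|i _]; rewrite ?sqr_ge0//.
rewrite big_ord_recl cons_rV0; under eq_bigr do rewrite cons_rVS.
by rewrite subr0 expr1n mulrDl opprD mulNr.
Qed.

Local Open Scope ereal_scope.

Let gaussian_set0 n : gaussian n set0 = 0.
Proof. by rewrite /gaussian integral_set0. Qed.

Let gaussian_ge0 n A : 0 <= gaussian n A.
Proof. by apply: integral_ge0 => x _; rewrite lee_fin gauss_pdf_ge0. Qed.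

Let gaussian_semi_sigma_additive n : semi_sigma_additive (gaussian n).
Proof.
move=> /= A mA tA mUA; rewrite /gaussian ge0_integral_bigcup//=.
- apply: is_cvg_ereal_nneg_natsum_cond => k _ _.
  by apply: integral_ge0 => x _; rewrite lee_fin gauss_pdf_ge0.
- by apply/measurable_funTS/measurable_EFinP; exact: measurable_gauss_pdf.
- by move=> x _; rewrite lee_fin gauss_pdf_ge0.
Qed.

HB.instance Definition _ n := isMeasure.Build _ _ _ (gaussian n)
  (@gaussian_set0 n) (@gaussian_ge0 n) (@gaussian_semi_sigma_additive n).

Let gaussian_setT n : gaussian n [set: 'rV[R]_n] = 1.
Proof.
rewrite /gaussian; elim: n => [|n IH] /=.
  rewrite integral_dirac//.
    rewrite diracE in_setT mul1e /gauss_pdf mul0r oppr0 powRr0 mul1r.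
    by rewrite /enorm big_ord0 sqrtr0 expr0n mul0r oppr0 expR0.
  by apply/measurable_EFinP; exact: measurable_gauss_pdf.
rewrite (ge0_integral_pushforward (@measurable_cons_rV R n))//=; last 2 first.
- by apply/measurable_EFinP; exact: measurable_gauss_pdf.
- by move=> x _; rewrite lee_fin gauss_pdf_ge0.
rewrite preimage_setT fubini_tonelli1//=; last 2 first.
- apply/measurable_EFinP; apply: measurableT_comp; first exact: measurable_gauss_pdf.
  exact: measurable_cons_rV.
- by move=> x; rewrite lee_fin gauss_pdf_ge0.
rewrite -[RHS](@integral_normal_pdf R 0%R 1%R); apply: eq_integral => x _.
rewrite /fubini_F /=.
under eq_integral do rewrite gauss_pdf_cons EFinM /=.
rewrite ge0_integralZl_EFin//=.
- by rewrite IH mule1.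
- by move=> y _; rewrite lee_fin gauss_pdf_ge0.
- by apply/measurable_EFinP; exact: measurable_gauss_pdf.
- exact: normal_pdf_ge0.
Qed.

HB.instance Definition _ n :=
  Measure_isProbability.Build _ _ _ (gaussian n) (@gaussian_setT n).

Definition gauss_mean n (f : 'rV[R]_n -> R) : R :=
  (\int[lebesgue_rV R n]_y (f y * gauss_pdf y))%R.

End gaussian.
Arguments gaussian : clear implicits.

(* The infimum of the empty set is +oo. *)
Definition luxemburg_norm d (T : measurableType d) (R : realType)
    (mu : {measure set T -> \bar R}) (Phi : R -> R) (f : T -> R) : \bar R :=
  ereal_inf [set a%:E | a in [set a : R | 0 < a /\
    (\int[mu]_x (Phi (a^-1 * `|f x|))%:E <= 1)%E]].

(* Young functions are only evaluated at nonnegative arguments. *)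
Section young_functions.
Variable R : realType.
Implicit Types x y : R.

(* Convex conjugate of x |-> e^x - 1 - x. *)
Definition exp2_conj y : R := (1 + y) * ln (1 + y) - y.

Definition cosh_sub1 x : R := (expR x + expR (- x)) / 2 - 1.

Definition gauss2 x : R := expR (x ^+ 2 / 2) - 1.

End young_functions.

(* Main.v *)
Require Import Defs.
From mathcomp Require Import all_boot all_order all_algebra.
From mathcomp Require Import all_classical all_reals all_analysis.
From mathcomp Require Import measurable_realfun ring lra.
From mathcomp Require mpoly.

Set Implicit Arguments.
Unset Strict Implicit.
Unset Printing Implicit Defensive.
Import Order.TTheory GRing.Theory Num.Def Num.Theory.
Import numFieldNormedType.Exports.

Local Open Scope classical_set_scope.
Local Open Scope ring_scope.

(* Maurey-Pisier argument. For x, y in R^n put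
     X_u = cos (pi u / 2) x + sin (pi u / 2) y, 0 <= u <= 1,
   so that f y - f x is the integral over u of (pi / 2) grad f (X_u) . Y_u, where
   (X_u, Y_u) is a rotation of (x, y). Jensen's inequality and the rotation
   invariance of gamma (x) gamma give, for every convex nondecreasing Phi,
     E Phi(|f - E f|) <= E Phi((pi / 2) |grad f(x)| |y|)
   with x, y independent Gaussian vectors. As the constants may depend on n, the
   scalar product is bounded by Cauchy-Schwarz; each of the three inequalities
   then follows from a bound of the integrand by a product A(x) k exp(|y|^2 / 4),
   the last factor being gamma-integrable. *)

(** * Densities and translations *)

(** Let K be the gamma-integral of exp(|y|^2 / 4). Any exponent factor below 1/2 keeps such an
    integral finite, while exp(|y|^2 / 4) still absorbs powers of |y|, and exp(k |y|) at the price
    of exp(k^2). The constants depend only on K and p, so they are fixed before f is. In the two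
    Luxemburg inequalities, the modular of (f - E f) / (C a) must come out at most 1. A factor 1/C
    that survives in the product bound forces this: it comes from a direct estimate for [exp2_conj]
    and from convexity for cosh - 1, and it then outweighs K. For powers, homogeneity of the norm
    plays this role. Rotation invariance rests on translations only. Lebesgue measure on R^n is an
    iterated product, so translations reduce to one coordinate at a time; a shear is a translation
    on every fibre; a rotation is made of shears. *)

Section density.
Local Open Scope ereal_scope.
Context d (T : measurableType d) (R : realType).
Variables (mu nu : {measure set T -> \bar R}) (p : T -> R).
Hypotheses (mp : measurable_fun [set: T] p) (p_ge0 : forall x, (0 <= p x)%R).
Hypothesis nuE : forall A, measurable A -> nu A = \int[mu]_(x in A) (p x)%:E.

Import HBNNSimple.

Let ge0_integral_density_nnsfun (g : {nnsfun T >-> R}) :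
  \int[nu]_x (g x)%:E = \int[mu]_x ((g x)%:E * (p x)%:E).
Proof.
under eq_integral do rewrite fimfunE -fsumEFin//.
rewrite ge0_integral_fsum//; last 2 first.
  - by move=> r; exact/measurable_EFinP/measurableT_comp.
  - by move=> r x _; rewrite EFinM nnfun_muleindic_ge0.
transitivity (\sum_(r \in range g)
    \int[mu]_x ((r * \1_(g @^-1` [set r]) x)%:E * (p x)%:E)).
  apply: eq_fsbigr => r _; rewrite integralZl_indic_nnsfun//=.
  rewrite integral_indic//= setIT.
  have [r0|r0] := leP 0%R r; last first.
    rewrite preimage_nnfun0// measure0 mule0.
    by under eq_integral do rewrite indic0 mulr0 mul0e; rewrite integral0.
  rewrite nuE// integral_mkcond.
  rewrite -ge0_integralZl_EFin//; last 2 first.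
  - by move=> x _; apply: erestrict_ge0 => y _; rewrite lee_fin.
  - apply/(measurable_restrictT _ _).1 => //.
    exact/measurable_funTS/measurable_EFinP.
  apply: eq_integral => x _; rewrite patchE indicE.
  by case: ifPn; rewrite ?mulr1 ?mulr0 ?mul0e ?mule0.
under [RHS]eq_integral do rewrite fimfunE -fsumEFin//.
under [RHS]eq_integral => x _ do (rewrite muleC ge0_mule_fsumr; last by move=> r;
  rewrite EFinM nnfun_muleindic_ge0).
rewrite ge0_integral_fsum//.
- by apply: eq_fsbigr => r _; apply: eq_integral => x _; rewrite muleC.
- move=> r; apply: emeasurable_funM; first exact/measurable_EFinP.
  by exact/measurable_EFinP/measurableT_comp.
- move=> r x _; apply: mule_ge0; first by rewrite lee_fin.
  by rewrite EFinM nnfun_muleindic_ge0.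
Qed.

(** For simple functions, linearity reduces the claim to [nuE] on level sets; monotone convergence
    along [nnsfun_approx] does the rest. *)
Lemma ge0_integral_density (f : T -> \bar R) :
  measurable_fun [set: T] f -> (forall x, 0 <= f x) ->
  \int[nu]_x f x = \int[mu]_x (f x * (p x)%:E).
Proof.
move=> mf f0; pose f_ := nnsfun_approx measurableT mf.
transitivity (limn (fun n => \int[nu]_x (f_ n x)%:E)).
  rewrite -monotone_convergence//=.
  - apply: eq_integral => x _; apply/esym/cvg_lim => //=.
    exact: cvg_nnsfun_approx.
  - by move=> n; exact/measurable_EFinP/measurable_funTS.
  - by move=> n x _; rewrite lee_fin.
  - by move=> x _ a b ab; rewrite lee_fin//; exact/lefP/nd_nnsfun_approx.
transitivity (limn (fun n => \int[mu]_x ((f_ n x)%:E * (p x)%:E))).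
  by congr (limn _); apply/funext => n; exact: ge0_integral_density_nnsfun.
rewrite -monotone_convergence//=.
- apply: eq_integral => x _; apply/cvg_lim => //=.
  by apply: cvgeZr => //; apply: cvg_nnsfun_approx.
- move=> n; apply: emeasurable_funM; exact/measurable_EFinP/measurable_funTS.
- by move=> n x _; rewrite mule_ge0// lee_fin.
- move=> x _ a b ab; rewrite lee_wpmul2r ?lee_fin//.
  exact/lefP/nd_nnsfun_approx.
Qed.

End density.

Section translation.
Context {R : realType}.
Local Open Scope ereal_scope.

(** The image measure gives every half-open interval its length, and this characterizes Lebesgue
    measure. *)
Lemma lebesgue_measure_shift (a : R) (A : set R) : measurable A ->
  pushforward (@lebesgue_measure R)
    ((fun x => x + a)%R : _ -> measurableTypeR R) A = lebesgue_measure A.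
Proof.
have ma : measurable_fun [set: measurableTypeR R] (fun x => x + a : measurableTypeR R)%R.
  exact: measurable_funD.
pose m := measure_function_pushforward__canonical__measure_function_Measure
  (@lebesgue_measure R) ma.
move=> mA; apply/esym.
apply: (@lebesgue_measure_unique _ m) => //= _ [[b c]] _ <-.
rewrite /m/= /pushforward.
rewrite (_ : _ @^-1` _ = `](b - a)%R, (c - a)%R]%classic); last first.
  by apply/seteqP; split=> x /=; rewrite !in_itv/= ltrBlDr lerBrDr.
rewrite !lebesgue_measure_itv/= !lte_fin ltrD2r.
by case: ifP => // _; rewrite -!EFinB; congr EFin; lra.
Qed.

Lemma ge0_integral_shift (a : R) (f : measurableTypeR R -> \bar R) :
  measurable_fun [set: measurableTypeR R] f -> (forall x, 0 <= f x) ->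
  \int[lebesgue_measure]_x f (x + a)%R = \int[lebesgue_measure]_x f x.
Proof.
move=> mf f0.
have ma : measurable_fun [set: measurableTypeR R] (fun x => x + a : measurableTypeR R)%R.
  exact: measurable_funD.
pose m := measure_function_pushforward__canonical__measure_function_Measure
  (@lebesgue_measure R) ma.
transitivity (\int[m]_x f x).
  by rewrite (ge0_integral_pushforward ma).
by apply: eq_measure_integral => A mA _; exact: lebesgue_measure_shift.
Qed.

(** Induction on n: by Tonelli, the first coordinate is shifted by the one-dimensional case and the
    others by the induction hypothesis. *)
Lemma ge0_integral_rV_shift n (v : 'rV[R]_n) (f : 'rV[R]_n -> \bar R) :
  measurable_fun [set: 'rV[R]_n] f -> (forall x, 0 <= f x) ->
  \int[lebesgue_rV R n]_x f (x + v)%R = \int[lebesgue_rV R n]_x f x.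
Proof.
have mD m (w : 'rV[R]_m) : measurable_fun [set: 'rV[R]_m] (fun x => x + w)%R.
  apply: measurable_fun_rVP => i.
  rewrite (_ : _ \o _ = fun x : 'rV[R]_m => rV_coord i x + w ord0 i)%R.
    by apply: measurable_funD => //; exact: measurable_rV_coord.
  by apply/funext => x; rewrite /rV_coord/= mxE.
elim: n v f => [|n IH] v f mf f0.
  by apply: eq_integral => x _; congr f; apply/rowP => -[].
have mc := @measurable_cons_rV R n.
rewrite /= !(ge0_integral_pushforward mc)//=; last first.
  exact: (measurableT_comp mf (mD _ v)).
have mfc : measurable_fun setT (fun p => f (@cons_rV R n p)).
  exact: (measurableT_comp mf mc).
have mfcv : measurable_fun setT (fun p => f (@cons_rV R n p + v)%R).
  exact: (measurableT_comp mf (measurableT_comp (mD _ v) mc)).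
rewrite !fubini_tonelli1//= /fubini_F/=.
pose v0 := v ord0 ord0; pose v' := (\row_j v ord0 (lift ord0 j))%R.
have E x y : (cons_rV (x, y) + v = cons_rV (x + v0, y + v'))%R.
  apply/rowP => i; rewrite mxE; case: (unliftP ord0 i) => [j|] ->.
    by rewrite !cons_rVS/= !mxE.
  by rewrite !cons_rV0.
have mF : measurable_fun setT (fun x => \int[lebesgue_rV R n]_y f (cons_rV (x, y))).
  exact: (@measurable_fun_fubini_tonelli_F _ _ (measurableTypeR R) 'rV[R]_n _
    (lebesgue_rV R n) (fun p => f (cons_rV p))).
under eq_integral => x _.
  under eq_integral => y _ do rewrite E.
  rewrite (IH v' (fun y => f (cons_rV (x + v0, y)%R)))//; last first.
    exact: (measurableT_comp mfc (measurable_pair1 _)).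
  over.
by rewrite (@ge0_integral_shift v0 (fun x => \int[lebesgue_rV R n]_y f (cons_rV (x, y))))//
  => x; apply: integral_ge0.
Qed.

End translation.

(** * Continuous functions and the sigma-algebra of coordinates *)

Section continuous_measurable.
Context {R : realType}.

(* [f] is the pointwise limit of the countably-valued functions
   [x |-> f (floor (k x) / k)]. *)
Lemma measurable_continuous_rV n (f : 'rV[R]_n -> R) :
  continuous f -> measurable_fun [set: 'rV[R]_n] f.
Proof.
move=> cf.
pose fl k (x : 'rV[R]_n) : 'rV[int]_n := \row_i Num.floor (x ord0 i * k.+1%:R).
pose r k (z : 'rV[int]_n) : 'rV[R]_n := \row_i ((z ord0 i)%:~R / k.+1%:R).
apply: (@measurable_fun_cvg _ _ _ _ (fun k x => f (r k (fl k x)))).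
  move=> k _ Y mY; rewrite setTI.
  (* Integer vectors are countable, so the preimage is a countable union of cells of [fl k], each a
     finite intersection of coordinate slabs. *)
  rewrite (_ : _ @^-1` Y = \bigcup_(z in [set z | Y (f (r k z))]) (fl k @^-1` [set z])).
    rewrite bigcup_mkcond; apply: countable_bigcupT_measurable => [|z].
      exact: countableP.
    case: ifP => // _.
    rewrite (_ : _ @^-1` _ = \bigcap_(i in [set: 'I_n])
        (@rV_coord R n i @^-1` `[(z ord0 i)%:~R / k.+1%:R, ((z ord0 i) + 1)%:~R / k.+1%:R[)).
      apply: fin_bigcap_measurable => // i _.
      by rewrite -[X in measurable X]setTI; exact: measurable_rV_coord.
    have k0 : 0 < k.+1%:R :> R by [].
    apply/seteqP; split => x /=.
      move=> <- i _ /=; rewrite in_itv/= !mxE /rV_coord.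
      by rewrite ler_pdivrMr// ltr_pdivlMr// floor_le floorD1_gt.
    move=> H; apply/rowP => i; have := H i Logic.I; rewrite /= in_itv/= mxE /rV_coord.
    by rewrite ler_pdivrMr// ltr_pdivlMr// => /andP[a b]; apply/floor_def; rewrite a.
  by apply/seteqP; split => [x Yx|x [z Yz /= ->]//]; exists (fl k x).
move=> x _; apply: (@cvg_comp _ _ _ (fun k => r k (fl k x)) f _ (nbhs x)); last exact: cf.
apply/cvg_ballP => e e0; near=> k; split=> // i j.
rewrite /r /fl !mxE [i]ord1 /ball/=.
have k0 : 0 < k.+1%:R :> R by [].
set y := (x ord0 j * k.+1%:R).
rewrite (_ : x ord0 j = y / k.+1%:R); last by rewrite mulfK// gt_eqF.
rewrite -mulrBl normrM.
rewrite (gtr0_norm (x := k.+1%:R^-1)) ?invr_gt0//.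
apply: (@le_lt_trans _ _ (1 * k.+1%:R^-1)).
  apply: ler_wpM2r; rewrite ?invr_ge0//.
  have := floor_itv y; rewrite intrD1 => /andP[a b].
  rewrite ger0_norm; lra.
by rewrite mul1r; near: k; exact: (near_infty_natSinv_lt (PosNum e0)).
Unshelve. all: by end_near.
Qed.

End continuous_measurable.

(** * Jensen's inequality and rotations *)

Section young.
Context {R : realType}.

(* Convexity, on the half-line, in the only form Jensen's inequality needs: a
   nondecreasing supporting line at every point. *)
Definition supported (Phi : R -> R) := forall m, 0 <= m ->
  exists2 k, 0 <= k & forall t, 0 <= t -> Phi m + k * (t - m) <= Phi t.

Variable Phi : R -> R.
Hypothesis sPhi : supported Phi.

Lemma supported_scale (b : R) : 0 <= b -> supported (fun t => Phi (b * t)).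
Proof.
move=> b0 m m0; have [k k0 H] := sPhi (mulr_ge0 b0 m0).
exists (k * b); first exact: mulr_ge0.
by move=> t t0; rewrite -mulrA mulrBr; exact/H/mulr_ge0.
Qed.

(** The supporting line at e t is evaluated at t and at 0. With weights e and 1 - e the slope terms
    cancel, because e (t - e t) + (1 - e) (0 - e t) = 0. *)
Lemma supported_contract (e t : R) : Phi 0 = 0 -> 0 <= e <= 1 -> 0 <= t ->
  Phi (e * t) <= e * Phi t.
Proof.
move=> P0 /andP[e0 e1] t0; have [k k0 H] := sPhi (mulr_ge0 e0 t0).
have := H _ t0; have := H _ (lexx 0); rewrite P0 => H0 Ht.
have E : Phi (e * t) = e * (Phi (e * t) + k * (t - e * t)) +
   (1 - e) * (Phi (e * t) + k * (0 - e * t)) by ring.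
rewrite E -[leRHS]addr0 lerD// ?ler_wpM2l// mulr_ge0_le0// subr_ge0//.
Qed.

Local Open Scope ereal_scope.
(** The supporting line at m is integrated over D. The integral of u may be infinite and m need only
    lie below it, which suffices since k >= 0. Adding the finite number k m to both sides avoids any
    subtraction of extended reals. *)
Lemma jensen d (T : measurableType d) (mu : {measure set T -> \bar R})
   (D : set T) (u : T -> R) (m : R) :
  measurable D -> mu D = 1 -> (forall x, 0 <= u x)%R ->
  measurable_fun setT u ->  measurable_fun setT (Phi \o u) ->
  (forall t, 0 <= Phi t)%R -> (0 <= m)%R ->
  m%:E <= \int[mu]_(x in D) (u x)%:E ->
  (Phi m)%:E <= \int[mu]_(x in D) (Phi (u x))%:E.
Proof.
move=> mD D1 u0 mu_meas mPu P0 m0 mle; have [k k0 H] := sPhi m0.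
have mu' : measurable_fun D (EFin \o u) by exact/measurable_EFinP/measurable_funTS.
have mPu' : measurable_fun D (EFin \o (Phi \o u)) by exact/measurable_EFinP/measurable_funTS.
have : (Phi m)%:E + k%:E * m%:E <= \int[mu]_(x in D) (Phi (u x))%:E + k%:E * m%:E.
  apply: (@le_trans _ _ ((Phi m)%:E + k%:E * \int[mu]_(x in D) (u x)%:E)).
    by rewrite leeD2l// lee_wpmul2l.
  rewrite -ge0_integralZl_EFin//; last by move=> x _; rewrite lee_fin.
  have -> : (Phi m)%:E = \int[mu]_(x in D) (Phi m)%:E.
    by rewrite integral_cst// D1 mule1.
  have -> : k%:E * m%:E = \int[mu]_(x in D) (k * m)%:E.
    by rewrite integral_cst// D1 mule1.
  rewrite -!ge0_integralD//=; last first.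
  all: try by move=> x _; rewrite ?lee_fin ?mulr_ge0.
  - exact: measurable_funeM.
  apply: ge0_le_integral => //.
  - by move=> x _; rewrite adde_ge0// ?lee_fin// mulr_ge0.
  - by apply: emeasurable_funD => //; exact: measurable_funeM.
  - by apply: emeasurable_funD.
  - move=> x _; rewrite lee_fin; have := H (u x) (u0 x); lra.
by rewrite -EFinM leeD2rE.
Qed.

End young.

(** * Rotation invariance of the product of two Gaussian measures *)

Section rotation.
Context {R : realType} (n : nat).
Local Open Scope ereal_scope.
Notation V := 'rV[R]_n.
Notation lam := (lebesgue_rV R n).
Notation gam := (gaussian R n).

Lemma ge0_integral_gaussian (f : V -> \bar R) :
  measurable_fun [set: V] f -> (forall x, 0 <= f x) ->
  \int[gam]_x f x = \int[lam]_x (f x * (gauss_pdf x)%:E).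
Proof.
move=> mf f0; apply: ge0_integral_density => //.
- exact: measurable_gauss_pdf.
- exact: gauss_pdf_ge0.
Qed.

Lemma measurable_fun_rV_add d (T : measurableType d) (f g : T -> V) :
  measurable_fun setT f -> measurable_fun setT g ->
  measurable_fun setT (fun x => f x + g x)%R.
Proof.
move=> mf mg; apply: measurable_fun_rVP => i.
rewrite (_ : _ \o _ = fun x => rV_coord i (f x) + rV_coord i (g x))%R.
  by apply: measurable_funD; apply: (measurableT_comp (measurable_rV_coord i)).
by apply/funext => x; rewrite /rV_coord/= mxE.
Qed.

Lemma measurable_fun_rV_scale d (T : measurableType d) (c : T -> R) (f : T -> V) :
  measurable_fun setT c -> measurable_fun setT f ->
  measurable_fun setT (fun x => c x *: f x)%R.
Proof.
move=> mc mf; apply: measurable_fun_rVP => i.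
rewrite (_ : _ \o _ = fun x => c x * rV_coord i (f x))%R.
  by apply: measurable_funM => //; apply: (measurableT_comp (measurable_rV_coord i)).
by apply/funext => x; rewrite /rV_coord/= mxE.
Qed.

(** For each fixed second coordinate y this is a translation by a y, so Tonelli applies. *)
Lemma ge0_integral_shear1 (a : R) (F : V * V -> \bar R) :
  measurable_fun setT F -> (forall p, 0 <= F p) ->
  \int[lam \x lam]_p F (p.1 + a *: p.2, p.2)%R = \int[lam \x lam]_p F p.
Proof.
move=> mF F0.
have mG : measurable_fun setT (fun p : V * V => F (p.1 + a *: p.2, p.2)%R).
  apply: (measurableT_comp mF); apply: measurable_fun_pair => //.
  by apply: measurable_fun_rV_add => //; apply: measurable_fun_rV_scale.
rewrite !fubini_tonelli2//; apply: eq_integral => y _.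
rewrite /fubini_G/= (@ge0_integral_rV_shift _ _ (a *: y)%R (fun x => F (x, y)))//.
exact: (measurableT_comp mF (measurable_pair2 _)).
Qed.

Lemma ge0_integral_shear2 (a : R) (F : V * V -> \bar R) :
  measurable_fun setT F -> (forall p, 0 <= F p) ->
  \int[lam \x lam]_p F (p.1, p.2 + a *: p.1)%R = \int[lam \x lam]_p F p.
Proof.
move=> mF F0.
have mG : measurable_fun setT (fun p : V * V => F (p.1, p.2 + a *: p.1)%R).
  apply: (measurableT_comp mF); apply: measurable_fun_pair => //.
  by apply: measurable_fun_rV_add => //; apply: measurable_fun_rV_scale.
rewrite !fubini_tonelli1//; apply: eq_integral => x _.
rewrite /fubini_F/= (@ge0_integral_rV_shift _ _ (a *: x)%R (fun y => F (x, y)))//.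
exact: (measurableT_comp mF (measurable_pair1 _)).
Qed.

(** With c and s the cosine and sine of an angle, the second component is the derivative of the
    first with respect to that angle. *)
Definition rot (c s : R) (p : V * V) : V * V :=
  (c *: p.1 + s *: p.2, c *: p.2 - s *: p.1)%R.

Lemma measurable_rot d (T : measurableType d) (c s : T -> R) (p : T -> V * V) :
  measurable_fun setT c -> measurable_fun setT s -> measurable_fun setT p ->
  measurable_fun setT (fun t => rot (c t) (s t) (p t)).
Proof.
move=> mc ms mp.
have mp1 : measurable_fun setT (fun t => (p t).1) by apply: (measurableT_comp _ mp).
have mp2 : measurable_fun setT (fun t => (p t).2) by apply: (measurableT_comp _ mp).
rewrite (_ : (fun t => _) = fun t => (c t *: (p t).1 + s t *: (p t).2,
  c t *: (p t).2 + (- s t) *: (p t).1)%R).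
  apply: measurable_fun_pair; apply: measurable_fun_rV_add;
    apply: measurable_fun_rV_scale => //; exact: measurable_funN.
by apply/funext => t; rewrite /rot scaleNr.
Qed.

(* A rotation by less than pi is a product of three shears. *)
Lemma ge0_integral_rot (c s : R) (F : V * V -> \bar R) :
  (c ^+ 2 + s ^+ 2 = 1)%R -> (0 < 1 + c)%R ->
  measurable_fun setT F -> (forall p, 0 <= F p) ->
  \int[lam \x lam]_p F (rot c s p) = \int[lam \x lam]_p F p.
Proof.
(* [t] is the tangent of the half angle, defined because 1 + c > 0. The shears have coefficients t,
   - s, t, and [st] and [tc] identify their product with [rot]. *)
move=> cs c1 mF F0; pose t := (s / (1 + c))%R.
have st : (s * t = 1 - c)%R.
  by rewrite /t mulrA -expr2 (_ : s ^+ 2 = (1 - c) * (1 + c))%R ?mulfK ?gt_eqF//; lra.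
have tc : (t * (1 + c) = s)%R by rewrite /t mulfVK ?gt_eqF.
have mG a : measurable_fun setT (fun p : V * V => F (p.1 + a *: p.2, p.2)%R).
  apply: (measurableT_comp mF); apply: measurable_fun_pair => //.
  by apply: measurable_fun_rV_add => //; apply: measurable_fun_rV_scale.
have mG2 a b : measurable_fun setT
    (fun p : V * V => F (p.1 + a *: (p.2 + b *: p.1), p.2 + b *: p.1)%R).
  have mS : measurable_fun setT (fun p : V * V => (p.1, p.2 + b *: p.1)%R).
    apply: measurable_fun_pair => //.
    by apply: measurable_fun_rV_add => //; apply: measurable_fun_rV_scale.
  exact: (measurableT_comp (mG a) mS).
rewrite -(ge0_integral_shear1 t mF F0).
rewrite -(@ge0_integral_shear2 (- s) (fun p => F (p.1 + t *: p.2, p.2)%R))//=.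
rewrite -(@ge0_integral_shear1 t (fun p =>
  F (p.1 + t *: (p.2 + - s *: p.1), p.2 + - s *: p.1)%R))//=.
apply: eq_integral => -[x y] _; congr F; rewrite /rot/=; congr (_, _);
  apply/rowP => i; rewrite !mxE.
- transitivity ((1 - s * t) * x ord0 i + t * (1 + (1 - s * t)) * y ord0 i)%R.
    by rewrite st (_ : 1 - (1 - c) = c)%R ?tc//; ring.
  ring.
- transitivity ((1 - s * t) * y ord0 i - s * x ord0 i)%R; last by ring.
  by rewrite st (_ : 1 - (1 - c) = c)%R//; ring.
Qed.

Lemma gauss_pdf_rot (c s : R) (p : V * V) : (c ^+ 2 + s ^+ 2 = 1)%R ->
  (gauss_pdf (rot c s p).1 * gauss_pdf (rot c s p).2 =
   gauss_pdf p.1 * gauss_pdf p.2)%R.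
Proof.
move=> cs; rewrite /gauss_pdf mulrACA [RHS]mulrACA -!expRD; congr (_ * expR _)%R.
rewrite -!opprD -!mulrDl; congr (- (_ / _))%R.
rewrite /enorm !sqr_sqrtr ?sumr_ge0// => [|i _|i _|i _|i _]; rewrite ?sqr_ge0//.
rewrite -!big_split/=; apply: eq_bigr => i _; rewrite /rot/= !mxE.
transitivity ((c ^+ 2 + s ^+ 2) * (p.1 ord0 i ^+ 2 + p.2 ord0 i ^+ 2))%R; first by ring.
by rewrite cs mul1r.
Qed.

(** The density formula is used once for each factor, inside and outside the iterated integral. *)
Lemma gaussian_prodE (F : V * V -> \bar R) :
  measurable_fun setT F -> (forall p, 0 <= F p) ->
  \int[gam \x gam]_p F p =
  \int[lam \x lam]_p (F p * (gauss_pdf p.1 * gauss_pdf p.2)%:E).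
Proof.
move=> mF F0.
have mg := @measurable_gauss_pdf R n.
have mp1 : measurable_fun setT (fun p : V * V => (gauss_pdf p.1)%:E).
  by apply/measurable_EFinP; apply: measurableT_comp.
have mp2 : measurable_fun setT (fun p : V * V => (gauss_pdf p.2)%:E).
  by apply/measurable_EFinP; apply: measurableT_comp.
have mG : measurable_fun setT (fun p => F p * (gauss_pdf p.1 * gauss_pdf p.2)%:E).
  apply: emeasurable_funM => //.
  by under eq_fun do rewrite EFinM; apply: emeasurable_funM.
have mFx x : measurable_fun setT (fun y => F (x, y)).
  exact: (measurableT_comp mF (measurable_pair1 _)).
rewrite !fubini_tonelli1//; last first.
  by move=> p; rewrite mule_ge0// lee_fin mulr_ge0// gauss_pdf_ge0.
rewrite ge0_integral_gaussian//=; last 2 first.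
- exact: measurable_fun_fubini_tonelli_F.
- by move=> x; exact: integral_ge0.
apply: eq_integral => x _; rewrite /fubini_F/= ge0_integral_gaussian//.
rewrite muleC -ge0_integralZl_EFin//.
- by apply: eq_integral => y _; rewrite EFinM; rewrite muleCA.
- by move=> y _; rewrite mule_ge0// lee_fin gauss_pdf_ge0.
- by apply: emeasurable_funM => //; exact/measurable_EFinP.
- exact: gauss_pdf_ge0.
Qed.

Lemma gaussian_rot (c s : R) (F : V * V -> \bar R) :
  (c ^+ 2 + s ^+ 2 = 1)%R -> (0 < 1 + c)%R ->
  measurable_fun setT F -> (forall p, 0 <= F p) ->
  \int[gam \x gam]_p F (rot c s p) = \int[gam \x gam]_p F p.
Proof.
move=> cs c1 mF F0.
have mg := @measurable_gauss_pdf R n.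
have mFr : measurable_fun setT (fun p => F (rot c s p)).
  by apply: (measurableT_comp mF); apply: measurable_rot.
rewrite !gaussian_prodE//.
under eq_integral do rewrite -(gauss_pdf_rot _ cs).
rewrite (@ge0_integral_rot c s (fun p => F p * (gauss_pdf p.1 * gauss_pdf p.2)%:E))//.
- apply: emeasurable_funM => //; apply/measurable_EFinP.
  by apply: measurable_funM; apply: measurableT_comp.
- by move=> p; rewrite mule_ge0// lee_fin mulr_ge0// gauss_pdf_ge0.
Qed.

End rotation.

(** * Arcs of rotation *)

Section enorm.
Context {R : realType} (n : nat).
Implicit Types x y : 'rV[R]_n.

Lemma enorm_ge0 x : 0 <= enorm x. Proof. exact: sqrtr_ge0. Qed.

Lemma sqr_enorm x : enorm x ^+ 2 = \sum_(i < n) x ord0 i ^+ 2.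
Proof. by rewrite sqr_sqrtr// sumr_ge0// => i _; exact: sqr_ge0. Qed.

Lemma enorm_eq0 x : enorm x = 0 -> x = 0.
Proof.
move=> x0; have := sqr_enorm x; rewrite x0 expr0n/= => /esym/eqP.
rewrite psumr_eq0 => [/allP xi0|i _]; last exact: sqr_ge0.
apply/rowP => i; rewrite mxE; apply/eqP; rewrite -sqrf_eq0.
by apply: (implyP (xi0 i _)) => //; rewrite mem_index_enum.
Qed.

(** With A and B the two norms, the sum of the squares (u_i B - v_i A)^2 equals 2 A B (A B - <u,
    v>). Since A B is cancelled, zero norms are treated apart; the absolute value comes from
    applying the bound to - x as well. *)
Lemma CauchySchwarz_enorm x y :
  `|\sum_(i < n) x ord0 i * y ord0 i| <= enorm x * enorm y.
Proof.
have main (u v : 'rV[R]_n) : \sum_(i < n) u ord0 i * v ord0 i <= enorm u * enorm v.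
  set A := enorm u; set B := enorm v.
  have [A0|A0] := eqVneq A 0.
    rewrite A0 mul0r big1// => i _.
    by rewrite (enorm_eq0 A0) mxE mul0r.
  have [B0|B0] := eqVneq B 0.
    rewrite B0 mulr0 big1// => i _.
    by rewrite (enorm_eq0 B0) mxE mulr0.
  have A1 : 0 < A by rewrite lt_neqAle eq_sym A0 enorm_ge0.
  have B1 : 0 < B by rewrite lt_neqAle eq_sym B0 enorm_ge0.
  have : 0 <= \sum_(i < n) (u ord0 i * B - v ord0 i * A) ^+ 2.
    by apply: sumr_ge0 => i _; exact: sqr_ge0.
  have -> : \sum_(i < n) (u ord0 i * B - v ord0 i * A) ^+ 2 =
     2 * (A * B) * (A * B - \sum_(i < n) u ord0 i * v ord0 i).
    transitivity (B ^+ 2 * A ^+ 2 + A ^+ 2 * B ^+ 2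
      - 2 * (A * B) * \sum_(i < n) u ord0 i * v ord0 i); last by ring.
    rewrite {1}(sqr_enorm u : A ^+ 2 = _) {2}(sqr_enorm v : B ^+ 2 = _) !mulr_sumr -sumrN -!big_split/=.
    by apply: eq_bigr => i _; ring.
  rewrite pmulr_rge0 ?subr_ge0// !mulr_gt0//.
rewrite ler_norml main andbT lerNl -sumrN.
have := main (- x) y; rewrite /enorm.
under eq_bigr do rewrite mxE mulNr.
by under [X in Num.sqrt X * _]eq_bigr do rewrite mxE sqrrN.
Qed.

Lemma measurable_enorm : measurable_fun [set: 'rV[R]_n] (@enorm R n).
Proof.
rewrite (_ : @enorm R n = Num.sqrt \o (fun x => enorm x ^+ 2)).
  apply: measurableT_comp; last exact: measurable_enorm_sq.
  by apply: continuous_measurable_fun; exact: sqrt_continuous.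
by apply/funext => x /=; rewrite sqrtr_sqr ger0_norm// enorm_ge0.
Qed.

End enorm.

Section path.
Context {R : realType} (n : nat) (f : 'rV[R]_n -> R).
Hypothesis df : forall x, differentiable f x.
Hypothesis cf : forall i : 'I_n, continuous ('D_(delta_mx ord0 i) f).
Notation V := 'rV[R]_n.

Lemma diff_gradE (v x : V) :
  'd f x v = \sum_(i < n) v ord0 i * grad f x ord0 i.
Proof.
rewrite {1}(row_sum_delta v) linear_sum; apply: eq_bigr => i _.
by rewrite linearZ/= mxE deriveE.
Qed.

Lemma measurable_grad : measurable_fun [set: V] (grad f).
Proof.
apply: measurable_fun_rVP => i.
rewrite (_ : _ \o _ = 'D_(delta_mx ord0 i) f); first exact: measurable_continuous_rV.
by apply/funext => x; rewrite /rV_coord/= mxE.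
Qed.

Let c (u : R) : R := cos (pi / 2 * u).
Let s (u : R) : R := sin (pi / 2 * u).

Let dlin (u : R) : is_derive u 1 (fun u : R => pi / 2 * u) (pi / 2).
Proof. by apply: is_derive_eq; rewrite /GRing.scale/= mulr1. Qed.

Let dc (u : R) : is_derive u 1 c (- s u * (pi / 2)).
Proof. exact: (is_derive1_comp (is_derive_cos _) (dlin u)). Qed.

Let ds (u : R) : is_derive u 1 s (c u * (pi / 2)).
Proof. exact: (is_derive1_comp (is_derive_sin _) (dlin u)). Qed.

Let X (x y : V) (u : R) : V := c u *: x + s u *: y.

(** Stated as a differential rather than a derivative, so that the chain rule for f along the arc
    applies directly. *)
Let dX x y u : is_diff u (X x y)
  (fun h => h *: ((pi / 2) *: (c u *: y - s u *: x))).
Proof.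
have Zl (k : R -> R) (k' : R) (v : V) : is_derive u 1 k k' ->
    is_diff u (fun u => k u *: v) (fun h : R => h *: (k' *: v)).
  move=> [dk kE]; have dk' : differentiable k u by exact/derivable1_diffP.
  apply: DiffDef; first exact: differentiableZl.
  rewrite (diffZl v dk') (deriv1E dk); apply/funext => h.
  by rewrite derive1E kE scalerA.
have H := is_diffD (Zl c _ x (dc u)) (Zl s _ y (ds u)).
rewrite (_ : (fun h => _) = (fun h : R => h *: ((- s u * (pi / 2)) *: x)) +
  (fun h : R => h *: ((c u * (pi / 2)) *: y))); first exact: H.
apply/funext => h; rewrite fctE -scalerDr; congr (_ *: _).
by apply/rowP => i; rewrite !mxE; ring.
Qed.

Lemma path_bound (x y : V) : ((`|f y - f x|)%:E <=
  \int[lebesgue_measure]_(u in `[0%R, 1%R])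
    (pi / 2 * (enorm (grad f (rot (c u) (s u) (x, y)).1) *
               enorm (rot (c u) (s u) (x, y)).2))%:E)%E.
Proof.
(* The derivative of f along the arc, written in coordinates so that its continuity follows from
   that of the partial derivatives. *)
pose G u := \sum_(i < n) ((pi / 2) * (c u *: y - s u *: x) ord0 i) *
   'D_(delta_mx ord0 i) f (X x y u).
have cX : continuous (X x y).
  by move=> u; apply: differentiable_continuous; have [] := dX x y u.
have cc : continuous c.
  by move=> u; apply/differentiable_continuous/derivable1_diffP; have [] := dc u.
have cs : continuous s.
  by move=> u; apply/differentiable_continuous/derivable1_diffP; have [] := ds u.
have cG : continuous G.
  apply: continuous_big => [|i _ u]; first exact: add_continuous.
  apply: cvgM.
    apply: cvgM; first exact: cvg_cst.
    rewrite (_ : (fun _ => _) = (fun u => c u * y ord0 i - s u * x ord0 i)).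
      rewrite !mxE; apply: cvgB; apply: cvgM; try exact: cvg_cst.
        exact: cc.
      exact: cs.
    by apply/funext => v; rewrite !mxE.
  exact: (continuous_comp (cX u) (cf (x := _))).
have dfX (u : R) : is_derive u 1 (f \o X x y) (G u).
  have [dXu dXE] := dX x y u.
  have dfu : differentiable (f \o X x y) u by exact: differentiable_comp.
  apply: DeriveDef; first exact/derivable1_diffP.
  rewrite deriveE// diff_comp//= dXE scale1r diff_gradE.
  by apply: eq_bigr => i _; rewrite !mxE.
have FTC : (\int[lebesgue_measure]_(u in `[0%R, 1%R]) (G u)%:E =
    (f y)%:E - (f x)%:E)%E.
  rewrite (@continuous_FTC2 _ G (f \o X x y))//=.
  - rewrite /X /c /s mulr1 mulr0 cos0 sin0 cos_pihalf sin_pihalf.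
    by rewrite !scale1r !scale0r addr0 add0r.
  - exact: continuous_subspaceT.
  - have cfX : continuous (f \o X x y).
      by move=> u; apply/differentiable_continuous/derivable1_diffP; have [] := dfX u.
    split; first by move=> u _; have [] := dfX u.
      by apply: cvg_at_right_filter; exact: cfX.
    by apply: cvg_at_left_filter; exact: cfX.
  - by move=> u _; rewrite derive1E; have [_ ->] := dfX u.
have mG : measurable_fun [set: R] G by exact: continuous_measurable_fun.
have mr : measurable_fun [set: measurableTypeR R] (fun u => rot (c u) (s u) (x, y)).
  apply: measurable_rot => //; exact: continuous_measurable_fun.
rewrite -[leLHS]/(`|(f y - f x)%:E|)%E EFinB -FTC.
apply: (le_trans (le_abse_integral _ _ _)) => //.
  exact/measurable_EFinP/measurable_funTS.
apply: ge0_le_integral => //.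
- exact/measurable_EFinP/measurable_funTS/measurableT_comp.
- apply/measurable_EFinP/measurable_funTS; apply: measurable_funM => //.
  apply: measurable_funM.
    apply: (measurableT_comp (@measurable_enorm R n)).
    apply: (measurableT_comp measurable_grad); exact: (measurableT_comp measurable_fst mr).
  apply: (measurableT_comp (@measurable_enorm R n)).
  exact: (measurableT_comp measurable_snd mr).
- move=> u _; rewrite lee_fin.
  have -> : G u = pi / 2 * \sum_(i < n) (grad f (X x y u)) ord0 i * (c u *: y - s u *: x) ord0 i.
    rewrite mulr_sumr; apply: eq_bigr => i _; rewrite [grad _ _ _ _]mxE; ring.
  rewrite normrM ger0_norm ?divr_ge0 ?pi_ge0// ler_wpM2l ?divr_ge0 ?pi_ge0//.
  exact: CauchySchwarz_enorm.
Qed.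

End path.

(** * The Maurey-Pisier inequality *)

Section moments.
Context {R : realType} (n : nat).
Notation V := 'rV[R]_n.
Local Open Scope ereal_scope.

Lemma coord_le_enorm (x : V) i : (`|x ord0 i| <= enorm x)%R.
Proof.
rewrite -sqrtr_sqr; apply: ler_wsqrtr; rewrite (bigD1 i)//= lerDl sumr_ge0// => j _.
exact: sqr_ge0.
Qed.

(** On exponents, k t <= k^2 + t^2 / 4 is the expansion of (k - t / 2)^2 >= 0. *)
Lemma expR_lin_gauss (k t : R) : (expR (k * t) <= expR (k ^+ 2) * expR (t ^+ 2 / 4))%R.
Proof.
rewrite -expRD ler_expR; have := sqr_ge0 (k - t / 2)%R; nra.
Qed.

(** Since |x_i| <= |x| <= exp |x|, a monomial of total degree [k m] is at most exp(k |x|) in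
    absolute value, hence at most exp(k^2) exp(|x|^2 / 4). *)
Lemma poly_bounded_gauss (f : V -> R) : poly_bounded f ->
  exists2 C : R, (0 <= C)%R & forall x, (`|f x| <= C * expR (enorm x ^+ 2 / 4))%R.
Proof.
move=> [P fP].
pose k (m : mpoly.multinom n) := ((\sum_(i < n) mpoly.fun_of_multinom m i)%N)%:R : R.
exists (\sum_(m <- mpoly.msupp P) `|mpoly.mcoeff m P| * expR (k m ^+ 2))%R.
  by apply: sumr_ge0 => m _; rewrite mulr_ge0// expR_ge0.
move=> x; apply: (le_trans (fP x)); apply: (le_trans (ler_norm _)).
rewrite mpoly.mevalE; apply: (le_trans (ler_norm_sum _ _ _)).
rewrite mulr_suml; apply: ler_sum => m _; rewrite normrM -mulrA ler_wpM2l//.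
apply: le_trans (expR_lin_gauss _ _).
rewrite normr_prod /k natr_sum mulr_suml expR_sum; apply: ler_prod => i _.
rewrite normr_ge0/= normrX mulrC expRM_natr lerXn2r ?nnegrE ?expR_ge0//.
apply: (le_trans (coord_le_enorm x i)).
by have := expR_ge1Dx (enorm x); lra.
Qed.

End moments.

(** * Gaussian integrability of exp(|x|^2 / 4) *)

Section gauss_exp.
Context {R : realType}.
Local Open Scope ereal_scope.

(** The exponent - x^2 / 2 + x^2 / 4 = - x^2 / 4 is that of a centred normal law of variance 2; the
    square root of 2 is the ratio of the normalizing constants. *)
Lemma normal_pdf_exp (x : R) :
  (expR (x ^+ 2 / 4) * normal_pdf 0 1 x = Num.sqrt 2 * normal_pdf 0 (Num.sqrt 2) x)%R.
Proof.
have s2 : (Num.sqrt 2 != 0 :> R)%R by rewrite gt_eqF// sqrtr_gt0.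
rewrite !normal_pdfE ?oner_eq0// /normal_peak /normal_fun !subr0 expr1n !sqr_sqrtr//.
rewrite mulrCA -expRD mulrA; congr (_ * expR _)%R; last by field.
by rewrite mul1r -mulrnAr sqrtrM// invfM mulrA divff// mul1r.
Qed.

(** Both the exponential and the density factor over coordinates, so each dimension multiplies the
    integral by the square root of 2. *)
Lemma gauss_exp_fin n :
  \int[gaussian R n]_x (expR (enorm x ^+ 2 / 4))%:E < +oo.
Proof.
have me k : measurable_fun [set: 'rV[R]_k] (fun x => expR (enorm x ^+ 2 / 4)).
  apply: measurableT_comp => //; apply: measurable_funM => //.
  exact: measurable_enorm_sq.
have mep k : measurable_fun [set: 'rV[R]_k] (fun x => (expR (enorm x ^+ 2 / 4) * gauss_pdf x)%:E).
  apply/measurable_EFinP; apply: measurable_funM; first exact: me.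
  exact: measurable_gauss_pdf.
rewrite ge0_integral_gaussian//; last by apply/measurable_EFinP; exact: me.
under eq_integral do rewrite -EFinM.
elim: n => [|n IH] /=.
  rewrite integral_dirac//; last exact: mep.
  by rewrite diracE in_setT mul1e ltry.
rewrite (ge0_integral_pushforward (@measurable_cons_rV R n))//=; last 2 first.
- exact: mep.
- by move=> x _; rewrite lee_fin mulr_ge0 ?expR_ge0 ?gauss_pdf_ge0.
rewrite preimage_setT fubini_tonelli1//=; last 2 first.
- exact: (measurableT_comp (mep n.+1) (@measurable_cons_rV R n)).
- by move=> x; rewrite lee_fin mulr_ge0 ?expR_ge0 ?gauss_pdf_ge0.
pose K := \int[lebesgue_rV R n]_x (expR (enorm x ^+ 2 / 4) * gauss_pdf x)%:E.
rewrite (_ : \int[_]_x _ = \int[lebesgue_measure]_x ((Num.sqrt 2 * normal_pdf 0 (Num.sqrt 2) x)%:E * K)).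
  rewrite ge0_integralZr//; last 3 first.
  - by apply/measurable_EFinP; apply: measurable_funM => //; exact: measurable_normal_pdf.
  - by move=> x _; rewrite lee_fin mulr_ge0// normal_pdf_ge0.
  - by apply: integral_ge0 => x _; rewrite lee_fin mulr_ge0 ?expR_ge0 ?gauss_pdf_ge0.
  under eq_integral do rewrite EFinM.
  rewrite ge0_integralZl_EFin//; last 2 first.
  - by move=> x _; rewrite lee_fin normal_pdf_ge0.
  - by apply/measurable_EFinP; exact: measurable_normal_pdf.
  rewrite integral_normal_pdf mule1.
  by rewrite lte_mul_pinfty// lee_fin.
apply: eq_integral => x _; rewrite /fubini_F /K -ge0_integralZl_EFin//.
- apply: eq_integral => y _ /=; rewrite gauss_pdf_cons/= -EFinM -normal_pdf_exp.
  rewrite !sqr_enorm big_ord_recl cons_rV0; under eq_bigr do rewrite cons_rVS.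
  by rewrite mulrDl expRD; congr EFin; ring.
- by move=> y _; rewrite lee_fin mulr_ge0 ?expR_ge0 ?gauss_pdf_ge0.
- exact: mep.
- by rewrite mulr_ge0 ?normal_pdf_ge0.
Qed.

End gauss_exp.

(** * Comparison of f - E f with the gradient *)

Section maurey_pisier.
Context {R : realType} (n : nat) (f : 'rV[R]_n -> R).
Hypothesis f_C1 : C1poly f.
Notation V := 'rV[R]_n.
Notation lam := (lebesgue_rV R n).
Notation gam := (gaussian R n).
Local Open Scope ereal_scope.

Lemma measurable_C1poly : measurable_fun [set: V] f.
Proof.
have [df _ _ _] := f_C1; apply: measurable_continuous_rV => x.
exact/differentiable_continuous/df.
Qed.

Lemma integral_gauss_pdf : \int[lam]_y (gauss_pdf y)%:E = 1.
Proof. exact: (probability_setT gam). Qed.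

Lemma integrable_gauss_pdf : lam.-integrable setT (EFin \o @gauss_pdf R n).
Proof.
have mg := @measurable_gauss_pdf R n.
apply/integrableP; split; first exact/measurable_EFinP.
under eq_integral => x _ do rewrite /= ger0_norm ?gauss_pdf_ge0//.
by rewrite integral_gauss_pdf ltry.
Qed.

(** Polynomial growth of f enters here. It makes [gauss_mean f] a genuine mean instead of the
    default value of [fine] at an infinite integral. *)
Lemma integrable_mul_gauss_pdf :
  lam.-integrable setT (EFin \o (fun y => f y * gauss_pdf y)%R).
Proof.
have mg := @measurable_gauss_pdf R n.
have mf := measurable_C1poly.
have [_ _ /poly_bounded_gauss [C C0 fC] _] := f_C1.
apply/integrableP; split; first by apply/measurable_EFinP/measurable_funM.
have mG : measurable_fun setT (fun x : V => (expR (enorm x ^+ 2 / 4))%:E).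
  apply/measurable_EFinP; apply: measurableT_comp => //; apply: measurable_funM => //.
  exact: measurable_enorm_sq.
apply: (@le_lt_trans _ _ (\int[gam]_x (C%:E * (expR (enorm x ^+ 2 / 4))%:E))).
  rewrite ge0_integral_gaussian//; last 2 first.
  - exact: measurable_funeM.
  - by move=> x; rewrite mule_ge0 ?lee_fin ?expR_ge0.
  apply: ge0_le_integral => //.
  - by apply: measurableT_comp => //; apply/measurable_EFinP/measurable_funM.
  - apply: emeasurable_funM; [exact: measurable_funeM|exact/measurable_EFinP].
  - move=> x _ /=; rewrite -!EFinM lee_fin normrM (ger0_norm (gauss_pdf_ge0 _)).
    by rewrite ler_wpM2r ?gauss_pdf_ge0.
rewrite ge0_integralZl_EFin//.
apply: lte_mul_pinfty; rewrite ?lee_fin//; exact: gauss_exp_fin.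
Qed.

(** The constant f x is itself a Gaussian integral, so the difference is the integral of f y - f x.
    The estimate serves as the hypothesis on m in [jensen]. *)
Lemma dist_gauss_mean (x : V) :
  (`|f x - gauss_mean f|)%:E <= \int[gam]_y (`|f y - f x|)%:E.
Proof.
have mf := measurable_C1poly.
have ig := integrable_gauss_pdf; have ifg := integrable_mul_gauss_pdf.
have mg := @measurable_gauss_pdf R n.
rewrite distrC -[leLHS]/(`|(gauss_mean f - f x)%:E|) EFinB.
rewrite {1}/gauss_mean /Rintegral fineK; last exact: (integrable_fin_num measurableT ifg).
rewrite -[(f x)%:E]mule1 -integral_gauss_pdf -integralZl//.
rewrite -integralB//; last exact: integrableZl.
rewrite ge0_integral_gaussian//; last first.
  by apply/measurable_EFinP; apply: measurableT_comp => //; exact: measurable_funB.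
have iB := integrableB measurableT ifg (integrableZl measurableT (f x) ig).
apply: (le_trans (le_abse_integral _ _ _)) => //.
  by have /integrableP[] := iB.
rewrite le_eqVlt; apply/orP; left; apply/eqP; apply: eq_integral => y _.
by rewrite /= -mulrBl normrM (ger0_norm (gauss_pdf_ge0 _)) EFinM.
Qed.

Variable Phi : R -> R.
Hypotheses (sPhi : supported Phi) (Phi_ge0 : forall t, (0 <= Phi t)%R)
  (mPhi : measurable_fun [set: R] Phi).

Let H (p : V * V) : R := (pi / 2 * (enorm (grad f p.1) * enorm p.2))%R.

Let H_ge0 p : (0 <= H p)%R.
Proof. by rewrite /H !mulr_ge0 ?enorm_ge0 ?invr_ge0// pi_ge0. Qed.

Lemma measurable_enorm_gradM : measurable_fun [set: V * V] H.
Proof.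
have [df cf _ _] := f_C1.
apply: measurable_funM => //; apply: measurable_funM.
  apply: (measurableT_comp (@measurable_enorm R n)).
  exact: (measurableT_comp (measurable_grad cf) measurable_fst).
exact: (measurableT_comp (@measurable_enorm R n) measurable_snd).
Qed.

Let rotu (p : V * V) (u : R) := rot (cos (pi / 2 * u)) (sin (pi / 2 * u)) p.

(** Measurability jointly in the pair and the angle is what the exchange of integrals requires. *)
Let mrotu : measurable_fun setT (fun pu : (V * V) * measurableTypeR R => rotu pu.1 pu.2).
Proof.
have ml : measurable_fun setT
    (fun pu : (V * V) * measurableTypeR R => pi / 2 * pu.2 : measurableTypeR R)%R.
  exact: measurable_funM.
apply: measurable_rot => //.
- apply: (measurableT_comp _ ml); apply: continuous_measurable_fun; exact: continuous_cos.
- apply: (measurableT_comp _ ml); apply: continuous_measurable_fun; exact: continuous_sin.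
Qed.

Lemma maurey_pisier : \int[gam]_x (Phi `|f x - gauss_mean f|)%:E <=
  \int[gam \x gam]_p (Phi (H p))%:E.
Proof.
have [df cf _ _] := f_C1; have mf := measurable_C1poly.
have mH := measurable_enorm_gradM.
have mD : measurable_fun setT (fun p : V * V => `|f p.2 - f p.1|%R).
  apply: measurableT_comp => //; apply: measurable_funB.
    exact: (measurableT_comp mf measurable_snd).
  exact: (measurableT_comp mf measurable_fst).
have mPD : measurable_fun setT (fun p : V * V => (Phi `|f p.2 - f p.1|)%:E).
  by apply/measurable_EFinP; apply: measurableT_comp.
(* Jensen in y for fixed x replaces the mean of f by an independent copy. *)
apply: (@le_trans _ _ (\int[gam \x gam]_p (Phi `|f p.2 - f p.1|)%:E)).
  rewrite fubini_tonelli1//; last by move=> p; rewrite lee_fin.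
  apply: ge0_le_integral => //.
  - by move=> x _; rewrite lee_fin.
  - apply/measurable_EFinP; apply: measurableT_comp => //.
    by apply: measurableT_comp => //; exact: measurable_funB.
  - by apply: measurable_fun_fubini_tonelli_F => // p; rewrite lee_fin.
  - move=> x _.
    have mx : measurable_fun setT (fun y => `|f y - f x|%R).
      by apply: measurableT_comp => //; exact: measurable_funB.
    apply: (@jensen _ _ sPhi _ _ gam setT (fun y => `|f y - f x|%R)) => //.
    + exact: probability_setT.
    + exact: measurableT_comp.
    + exact: dist_gauss_mean.
pose I : set (measurableTypeR R) := `[0%R, 1%R]%classic.
(* The indicator turns the integral over [0, 1] into one over the whole line, so that Tonelli
   applies to the full measures. *)
pose G (q : (V * V) * measurableTypeR R) := (Phi (H (rotu q.1 q.2)))%:E * (\1_I q.2)%:E.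
have mHr : measurable_fun setT (fun q : (V * V) * measurableTypeR R => H (rotu q.1 q.2)).
  exact: (measurableT_comp mH mrotu).
have mG : measurable_fun setT G.
  apply: emeasurable_funM; first by apply/measurable_EFinP; apply: measurableT_comp.
  apply/measurable_EFinP; apply: measurableT_comp => //.
  by apply: measurable_indic; exact: measurable_itv.
have G0 q : 0 <= G q by rewrite mule_ge0 ?lee_fin.
have I1 : lebesgue_measure I = 1.
  by rewrite /I lebesgue_measure_itv/= lte_fin ltr01 -EFinB subr0.
(* Jensen in u, on an interval of length one, for each fixed pair (x, y). *)
have st : \int[gam \x gam]_p (Phi `|f p.2 - f p.1|)%:E <=
    \int[gam \x gam]_p \int[lebesgue_measure]_u G (p, u).
  apply: ge0_le_integral => //.
  - by move=> p _; rewrite lee_fin.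
  - apply: (@measurable_fun_fubini_tonelli_F _ _ _ _ _ _ G) => //.
  - move=> -[x y] _ /=.
    have mHp : measurable_fun setT (fun u : measurableTypeR R => H (rotu (x, y) u)).
      exact: (measurableT_comp mHr (measurable_pair1 (x, y))).
    rewrite (_ : \int[_]_u _ = \int[lebesgue_measure]_(u in I) (Phi (H (rotu (x, y) u)))%:E); last first.
      by rewrite [RHS]integral_mkcond epatch_indic.
    apply: (@jensen _ _ sPhi _ _ lebesgue_measure I (fun u => H (rotu (x, y) u))) => //.
    + exact: measurable_itv.
    + exact: measurableT_comp.
    + exact: path_bound.
have FT : \int[gam \x gam]_p \int[lebesgue_measure]_u G (p, u) =
    \int[lebesgue_measure]_u \int[gam \x gam]_p G (p, u).
  exact: (@fubini_tonelli _ _ _ _ R (product_subprobability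
    (gam : subprobability V R, gam : subprobability V R)) lebesgue_measure G mG G0).
apply: (le_trans st); rewrite FT.
(* By rotation invariance the inner integral does not depend on u in [0, 1], so averaging over u
   returns it unchanged. *)
rewrite (eq_integral (fun u => (\int[gam \x gam]_p (Phi (H p))%:E) * (\1_I u)%:E)).
  rewrite ge0_integralZl//.
  - rewrite integral_indic//=; last exact: measurable_itv.
    by rewrite setIT I1 mule1.
  - by apply/measurable_EFinP; apply: measurable_indic; exact: measurable_itv.
  - by apply: integral_ge0 => p _; rewrite lee_fin.
move=> u _; rewrite /G/= indicE; have [uI|uI] := boolP (u \in I); last first.
  by rewrite mule0; under eq_integral do rewrite mule0; rewrite integral0.
rewrite mule1; under eq_integral do rewrite mule1.
apply: (@gaussian_rot R n _ _ (fun p => (Phi (H p))%:E)) => //.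
- exact: cos2Dsin2.
(* The angle stays in [0, pi / 2], where the cosine is nonnegative, as [gaussian_rot] needs. *)
- move: uI; rewrite inE /I/= in_itv/= => /andP[u0 u1].
  rewrite ltr_wpDr// cos_ge0_pihalf//; have := @pi_ge0 R; nra.
- by apply/measurable_EFinP; apply: measurableT_comp.
- by move=> p; rewrite lee_fin.
Qed.

End maurey_pisier.

(** * Young functions *)

Section young_functions.
Context {R : realType}.
Implicit Types x y a b m t q : R.

Lemma ln_geB1V x : 0 < x -> 1 - x^-1 <= ln x.
Proof.
move=> x0; have := expR_ge1Dx (- ln x).
by rewrite expRN lnK ?posrE//; lra.
Qed.

(** The slope ln(1 + m) is the derivative at m. The claim is ln z >= 1 - 1/z at z = (1 + t) / (1 +
    m), multiplied by 1 + t. *)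
Lemma exp2_conj_tangent m t : 0 <= m -> 0 <= t ->
  exp2_conj m + ln (1 + m) * (t - m) <= exp2_conj t.
Proof.
move=> m0 t0; have a0 : 0 < 1 + t by lra.
have b0 : 0 < 1 + m by lra.
have := ln_geB1V (divr_gt0 a0 b0); rewrite ln_div ?posrE// invf_div => h.
have : (1 + t) * (1 - (1 + m) / (1 + t)) <= (1 + t) * (ln (1 + t) - ln (1 + m)).
  by rewrite ler_pM2l.
rewrite mulrBr mulr1 [X in _ - X <= _]mulrCA mulfV ?gt_eqF// mulr1 /exp2_conj; lra.
Qed.

Lemma supported_exp2_conj : supported (@exp2_conj R).
Proof.
move=> m m0; exists (ln (1 + m)); first by rewrite ln_ge0// lerDl.
by move=> t; exact: exp2_conj_tangent.
Qed.

(** Holds on the whole line, as [maurey_pisier] asks of Phi: for 1 + y <= 0, [ln] has its default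
    value 0 and - y > 0 remains. *)
Lemma exp2_conj_ge0 y : 0 <= exp2_conj y.
Proof.
rewrite /exp2_conj; have [y0|y0] := ltP 0 (1 + y); last first.
  by rewrite ln0// mulr0; lra.
have : (1 + y) * (1 - (1 + y)^-1) <= (1 + y) * ln (1 + y).
  by rewrite ler_pM2l// ln_geB1V.
rewrite mulrBr mulr1 mulfV ?gt_eqF//; lra.
Qed.

Lemma measurable_exp2_conj : measurable_fun [set: R] (@exp2_conj R).
Proof.
have m1 : measurable_fun [set: R] (fun y : R => 1 + y) by exact: measurable_funD.
apply: measurable_funB => //; apply: measurable_funM => //.
exact: (measurableT_comp (@measurable_ln R) m1).
Qed.

(* Young's inequality for [t] and [m `^ (q - 1)] *)
Lemma powR_tangent q m t : 1 < q -> 0 < m -> 0 <= t ->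
  m `^ q + q * m `^ (q - 1) * (t - m) <= t `^ q.
Proof.
move=> q1 m0 t0; have q0 : 0 < q by lra.
have q'0 : 0 < q / (q - 1) by rewrite divr_gt0// subr_gt0.
have pq : q^-1 + (q / (q - 1))^-1 = 1 by rewrite invf_div; field; lra.
have := conjugate_powR t0 (powR_ge0 m (q - 1)) q0 q'0 pq.
rewrite -powRrM mulrC (_ : (q - 1) * (q / (q - 1)) = q); last by field; lra.
have mE : m * m `^ (q - 1) = m `^ q.
  rewrite -[X in X * _](powRr1 (ltW m0)) -powRD ?(gt_eqF m0) ?implybT//.
  by congr (_ `^ _); lra.
rewrite invf_div -mE => h.
have : q * (m `^ (q - 1) * t) <=
    q * (t `^ q / q + m * m `^ (q - 1) * ((q - 1) / q)) by rewrite ler_pM2l.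
rewrite (_ : q * (t `^ q / q + _) = t `^ q + (q - 1) * (m * m `^ (q - 1)));
  last by field; lra.
lra.
Qed.

Lemma supported_powR q : 1 < q -> supported (fun t : R => t `^ q).
Proof.
move=> q1 m m0; have q0 : 0 < q by lra.
have [->|m_neq0] := eqVneq m 0.
  exists 0 => // t _; rewrite mul0r addr0 powR0 ?gt_eqF//; exact: powR_ge0.
exists (q * m `^ (q - 1)); first by rewrite mulr_ge0 ?powR_ge0// ltW.
by move=> t t0; apply: powR_tangent => //; rewrite lt_neqAle eq_sym m_neq0.
Qed.

(** Separates the factor carrying |y| from the one carrying the gradient. It combines (1 + v) ln(1 +
    v) - v <= v ln(1 + v) for v = a b, Bernoulli's inequality 1 + a b <= (1 + b)^(1 + a), and a
    lower bound for [exp2_conj b]. *)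
Lemma exp2_conj_mul a b : 0 <= a -> 0 <= b ->
  exp2_conj (a * b) <= 4 * (a + a ^+ 2) * exp2_conj b.
Proof.
move=> a0 b0; have ab0 := mulr_ge0 a0 b0.
have up : exp2_conj (a * b) <= a * b * ln (1 + a * b).
  have : ln (1 + a * b) <= a * b.
    by rewrite -ler_expR lnK ?expR_ge1Dx// posrE; lra.
  rewrite /exp2_conj; lra.
have mid : ln (1 + a * b) <= (1 + a) * ln (1 + b).
  rewrite -ln_powR ler_ln ?posrE ?powR_gt0//; try lra.
  have [->|a_neq0] := eqVneq a 0; first by rewrite mul0r !addr0 powRr1; lra.
  have a1 : 1 < 1 + a by rewrite ltrDl lt_neqAle eq_sym a_neq0.
  have b1 : 0 <= 1 + b by lra.
  have := powR_tangent a1 ltr01 b1; rewrite !powR1; lra.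
(* The tangent at b / 2 gives (b / 2) ln(1 + b / 2), and 1 + b <= (1 + b / 2)^2 costs another factor
   2: hence the 4. *)
have low : b * ln (1 + b) <= 4 * exp2_conj b.
  have b20 : 0 <= b / 2 by lra.
  have := exp2_conj_tangent b20 b0; have := exp2_conj_ge0 (b / 2).
  have : ln (1 + b) <= ln (1 + b / 2) *+ 2.
    rewrite -lnXn; last by lra.
    by rewrite ler_ln ?posrE ?exprn_gt0//; nra.
  rewrite mulr2n => h h1 h2.
  have : b * ln (1 + b) <= b * (ln (1 + b / 2) + ln (1 + b / 2)) by rewrite ler_wpM2l.
  lra.
apply: (le_trans up); apply: (@le_trans _ _ (a * b * ((1 + a) * ln (1 + b)))).
  by rewrite ler_wpM2l.
rewrite (_ : a * b * _ = (a + a ^+ 2) * (b * ln (1 + b))); last by ring.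
rewrite (_ : 4 * _ * _ = (a + a ^+ 2) * (4 * exp2_conj b)); last by ring.
by rewrite ler_wpM2l// addr_ge0// sqr_ge0.
Qed.

(** The slope is sinh m, nonnegative for m >= 0; the line is the half-sum of the tangents at m to
    exp(t) and exp(- t). *)
Lemma supported_cosh_sub1 : supported (@cosh_sub1 R).
Proof.
move=> m m0; exists ((expR m - expR (- m)) / 2).
  by rewrite divr_ge0// subr_ge0 ler_expR; lra.
move=> t t0; rewrite /cosh_sub1.
have : expR m * (1 + (t - m)) <= expR t.
  rewrite -[leRHS](_ : expR m * expR (t - m) = _); last by rewrite -expRD; congr expR; lra.
  by rewrite ler_pM2l ?expR_gt0// expR_ge1Dx.
have : expR (- m) * (1 + (m - t)) <= expR (- t).
  rewrite -[leRHS](_ : expR (- m) * expR (m - t) = _); last by rewrite -expRD; congr expR; lra.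
  by rewrite ler_pM2l ?expR_gt0// expR_ge1Dx.
lra.
Qed.

Lemma cosh_sub1_0 : @cosh_sub1 R 0 = 0.
Proof. by rewrite /cosh_sub1 oppr0 expR0; lra. Qed.

Lemma cosh_sub1_ge0 x : 0 <= cosh_sub1 x.
Proof. by rewrite /cosh_sub1; have := expR_ge1Dx x; have := expR_ge1Dx (- x); lra. Qed.

Lemma measurable_cosh_sub1 : measurable_fun [set: R] (@cosh_sub1 R).
Proof.
apply: measurable_funB => //; apply: measurable_funM => //; apply: measurable_funD => //.
by apply: measurableT_comp.
Qed.

Lemma cosh_sub1_le x : 0 <= x -> cosh_sub1 x <= expR x.
Proof.
move=> x0; rewrite /cosh_sub1; have : expR (- x) <= expR x by rewrite ler_expR; lra.
have := expR_gt0 x; lra.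
Qed.

End young_functions.

(** * From Young functions to norms *)

Section luxemburg.
Local Open Scope ereal_scope.

(** Each scale a admissible for h yields the scale C a for g. If no a is admissible, the right-hand
    side is infinite and nothing remains to be shown. *)
Lemma luxemburg_norm_le d (T : measurableType d) (R : realType)
    (mu : {measure set T -> \bar R}) (Phi Psi : R -> R) (g h : T -> R) (C : R) :
  (0 < C)%R ->
  (forall a, (0 < a)%R -> \int[mu]_x (Psi (a^-1 * `|h x|)%R)%:E <= 1 ->
    \int[mu]_x (Phi ((C * a)^-1 * `|g x|)%R)%:E <= 1) ->
  luxemburg_norm mu Phi g <= C%:E * luxemburg_norm mu Psi h.
Proof.
move=> C0 H; rewrite -lee_pdivrMl//; apply: le_ereal_inf_tmp => _ [a [a0 ha] <-].
rewrite lee_pdivrMl//; apply: ereal_inf_lbound; exists (C * a)%R; last by rewrite EFinM.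
by split; [exact: mulr_gt0 | exact: H].
Qed.

End luxemburg.

Section gaussian_young_poincare.
Context {R : realType} (n : nat) (f : 'rV[R]_n -> R).
Hypothesis f_C1 : C1poly f.
Notation V := 'rV[R]_n.
Notation gam := (gaussian R n).
Local Open Scope ereal_scope.

Let E (y : V) : R := expR (enorm y ^+ 2 / 4).

Lemma measurable_gauss_exp : measurable_fun [set: V] E.
Proof.
apply: measurableT_comp => //; apply: measurable_funM => //.
exact: measurable_enorm_sq.
Qed.

Lemma measurable_enorm_grad : measurable_fun [set: V] (fun x => enorm (grad f x)).
Proof.
have [_ cf _ _] := f_C1.
exact: (measurableT_comp (@measurable_enorm R n) (measurable_grad cf)).
Qed.

(** Once the integrand is dominated by a product, Tonelli splits the double integral. In use, b is
    the inverse Luxemburg scale, or 1 for powers, and k carries the small factor that compensates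
    the integral of [E]. *)
Lemma maurey_pisier_product (Phi : R -> R) (b k : R) (A : V -> R) :
  supported Phi -> (forall t, 0 <= Phi t)%R -> measurable_fun [set: R] Phi ->
  (0 <= b)%R -> (0 <= k)%R -> (forall x, 0 <= A x)%R -> measurable_fun [set: V] A ->
  (forall x y, Phi (b * (pi / 2 * (enorm (grad f x) * enorm y))) <= A x * (k * E y))%R ->
  \int[gam]_x (Phi (b * `|f x - gauss_mean f|)%R)%:E <=
  (\int[gam]_x (A x)%:E) * (k%:E * \int[gam]_y (E y)%:E).
Proof.
move=> sP P0 mP b0 k0 A0 mA PA.
have mb : measurable_fun [set: R] (fun t : R => b * t)%R by exact: measurable_funM.
have mPb : measurable_fun [set: R] (fun t => Phi (b * t)%R) by exact: (measurableT_comp mP mb).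
apply: (le_trans (maurey_pisier f_C1 (supported_scale sP b0) (fun t => P0 _) mPb)).
have mE := measurable_gauss_exp.
have mAE : measurable_fun setT (fun p : V * V => (A p.1 * (k * E p.2))%:E).
  apply/measurable_EFinP; apply: measurable_funM.
    exact: (measurableT_comp mA measurable_fst).
  apply: measurable_funM => //; exact: (measurableT_comp mE measurable_snd).
have mPH := measurableT_comp mPb (measurable_enorm_gradM f_C1).
apply: (@le_trans _ _ (\int[gam \x gam]_p (A p.1 * (k * E p.2))%:E)).
  apply: ge0_le_integral => //.
  - by move=> p _; rewrite lee_fin.
  - exact/measurable_EFinP.
  - by move=> p _; rewrite lee_fin.
have E0 y : (0 <= E y)%R by exact: expR_ge0.
rewrite fubini_tonelli1//; last by move=> p; rewrite lee_fin !mulr_ge0.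
rewrite /fubini_F/=.
have iE0 : 0 <= \int[gam]_y (E y)%:E by apply: integral_ge0 => y _; rewrite lee_fin.
under eq_integral => x _.
  under eq_integral => y _ do rewrite mulrA EFinM.
  rewrite ge0_integralZl_EFin//; first last.
  - exact: mulr_ge0.
  - exact/measurable_EFinP.
  - by move=> y _; rewrite lee_fin.
  rewrite EFinM -muleA; over.
rewrite ge0_integralZr//.
- exact/measurable_EFinP.
- by move=> x _; rewrite lee_fin.
- by rewrite mule_ge0.
Qed.

End gaussian_young_poincare.

(** * The three inequalities *)

Section gaussian_poincare.
Context {R : realType} (n : nat).
Notation V := 'rV[R]_n.
Notation gam := (gaussian R n).
Local Open Scope ereal_scope.

Lemma ex_gauss_exp_integral : exists2 K : R, (0 <= K)%R &
  \int[gam]_x (expR (enorm x ^+ 2 / 4))%:E = K%:E.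
Proof.
have I0 : 0 <= \int[gam]_x (expR (enorm x ^+ 2 / 4))%:E.
  by apply: integral_ge0 => x _; rewrite lee_fin expR_ge0.
exists (fine (\int[gam]_x (expR (enorm x ^+ 2 / 4))%:E)); first exact: fine_ge0.
by rewrite fineK// ge0_fin_numE// gauss_exp_fin.
Qed.

Variables (K : R) (f : V -> R).
Hypotheses (K0 : (0 <= K)%R)
  (KE : \int[gam]_x (expR (enorm x ^+ 2 / 4))%:E = K%:E) (f_C1 : C1poly f).
Let g x : R := (f x - gauss_mean f)%R.
Let h x : R := enorm (grad f x).

Let mh : measurable_fun [set: V] h. Proof. exact: measurable_enorm_grad. Qed.
Let h0 x : (0 <= h x)%R. Proof. exact: enorm_ge0. Qed.
Let pi0 : (0 <= pi :> R)%R. Proof. exact: pi_ge0. Qed.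

(** Bounds 4 (a + a^2) at a = (pi / 2) e by a multiple of exp(e^2 / 4), using e <= exp(e^2 / 4) and
    e^2 <= 4 exp(e^2 / 4). *)
Let c1 : R := (4 * (pi / 2 + 4 * (pi / 2) ^+ 2))%R.
Let c1_ge0 : (0 <= c1)%R.
Proof. by rewrite /c1 mulr_ge0// addr_ge0 ?mulr_ge0 ?sqr_ge0// divr_ge0. Qed.

(** The factor |y| / C goes into the first argument of [exp2_conj_mul]. The constant C = 1 + c1 K
    satisfies both C >= 1 and c1 K / C <= 1. *)
Lemma exp2_conj_poincare :
  luxemburg_norm gam (@exp2_conj R) g <=
  (1 + c1 * K)%:E * luxemburg_norm gam (@exp2_conj R) h.
Proof.
set C := (1 + c1 * K)%R; have cK : (0 <= c1 * K)%R by exact: mulr_ge0.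
have C1 : (1 <= C)%R by rewrite lerDl.
have C0 : (0 < C)%R by exact: lt_le_trans C1.
apply: luxemburg_norm_le => // a a0 ha.
have mh' : measurable_fun [set: R] (fun t : R => a^-1 * `|t|)%R.
  by apply: measurable_funM => //; exact: measurableT_comp.
have Ca0 : (0 <= (C * a)^-1)%R by rewrite invr_ge0 mulr_ge0 ?ltW.
apply: (le_trans (@maurey_pisier_product R n f f_C1 (@exp2_conj R) (C * a)^-1
    (C^-1 * c1)%R (fun x => exp2_conj (a^-1 * `|h x|)%R)
    (supported_exp2_conj (R := R)) (exp2_conj_ge0 (R := R)) (measurable_exp2_conj (R := R))
    Ca0 _ _ _ _)).
- by rewrite mulr_ge0// invr_ge0 ltW.
- by move=> x; exact: exp2_conj_ge0.
- exact: (measurableT_comp (@measurable_exp2_conj R) (measurableT_comp mh' mh)).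
- move=> x y; set e := enorm y; have e0 : (0 <= e)%R by exact: enorm_ge0.
  rewrite ger0_norm// -/(h x).
  rewrite (_ : (C * a)^-1 * _ = (pi / 2 * e / C) * (a^-1 * h x))%R; last first.
    by rewrite invfM; ring.
  have u0 : (0 <= pi / 2 * e)%R by rewrite mulr_ge0// divr_ge0.
  have v0 : (0 <= pi / 2 * e / C)%R by rewrite divr_ge0// ltW.
  have w0 : (0 <= a^-1 * h x)%R by rewrite mulr_ge0// invr_ge0 ltW.
  apply: (le_trans (exp2_conj_mul v0 w0)).
  rewrite mulrC ler_wpM2l ?exp2_conj_ge0//.
  have C'1 : (C^-1 <= 1)%R by rewrite invf_le1.
  have C'0 : (0 <= C^-1)%R by rewrite invr_ge0 ltW.
  (* C >= 1 gives C^-2 <= C^-1, so one factor C^-1 comes out of the quadratic term as well. *)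
  have s1 : ((pi / 2 * e / C) ^+ 2 <= C^-1 * (pi / 2 * e) ^+ 2)%R.
    rewrite exprMn mulrC ler_wpM2r ?sqr_ge0//.
    by rewrite expr2 -[leRHS]mulr1 ler_wpM2l.
  have s2 : (e <= expR (e ^+ 2 / 4))%R.
    by have := expR_ge1Dx (e ^+ 2 / 4); have := sqr_ge0 (e / 2 - 1); nra.
  have s3 : (e ^+ 2 <= 4 * expR (e ^+ 2 / 4))%R.
    by have := expR_ge1Dx (e ^+ 2 / 4); lra.
  set E := expR _ in s2 s3 *.
  have s4 : (pi / 2 * e + (pi / 2 * e) ^+ 2 <= (pi / 2 + 4 * (pi / 2) ^+ 2) * E)%R.
    rewrite [leRHS]mulrDl; apply: lerD; first by rewrite ler_wpM2l// divr_ge0.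
    by rewrite exprMn [leRHS]mulrAC [leRHS]mulrC ler_wpM2l// sqr_ge0.
  apply: (@le_trans _ _ (4 * (C^-1 * (pi / 2 * e + (pi / 2 * e) ^+ 2)))%R).
    rewrite ler_wpM2l// mulrDr lerD// mulrC//.
  rewrite /c1 (_ : _ * E = 4 * (C^-1 * ((pi / 2 + 4 * (pi / 2) ^+ 2) * E)))%R.
    by rewrite ler_wpM2l// ler_wpM2l.
  ring.
rewrite KE -EFinM.
apply: (@le_trans _ _ (1 * (C^-1 * c1 * K)%:E)).
  apply: lee_wpmul2r; last exact: ha.
  by rewrite lee_fin mulr_ge0// mulr_ge0// invr_ge0 ltW.
rewrite mul1e lee_fin -mulrA mulrC ler_pdivrMr// mul1r /C; lra.
Qed.

(** Dividing by pi leaves the argument s |y| / 2 with s = |grad f| / a, and exp(s |y| / 2) <=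
    exp(s^2 / 4) exp(|y|^2 / 4); this is where [gauss2] comes from. The remaining 1 + 2 K
    compensates K and the bound 2 on the integral of exp(s^2 / 2). *)
Lemma cosh_sub1_poincare :
  luxemburg_norm gam (@cosh_sub1 R) g <=
  (pi * (1 + 2 * K))%:E * luxemburg_norm gam (@gauss2 R) h.
Proof.
set N := (1 + 2 * K)%R.
have N1 : (1 <= N)%R by rewrite lerDl mulr_ge0.
have N0 : (0 < N)%R by exact: lt_le_trans N1.
have pi1 : (0 < pi :> R)%R by exact: pi_gt0.
apply: luxemburg_norm_le => [|a a0 ha]; first exact: mulr_gt0.
set C := (pi * N)%R.
have Ca0 : (0 <= (C * a)^-1)%R by rewrite invr_ge0 !mulr_ge0 ?ltW.
have mA : measurable_fun [set: V] (fun x => expR ((a^-1 * `|h x|) ^+ 2 / 2)).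
  apply: measurableT_comp => //; apply: measurable_funM => //.
  apply: measurable_funX; apply: measurable_funM => //; exact: measurableT_comp.
apply: (le_trans (@maurey_pisier_product R n f f_C1 (@cosh_sub1 R) (C * a)^-1
    N^-1 (fun x => expR ((a^-1 * `|h x|) ^+ 2 / 2))
    (supported_cosh_sub1 (R := R)) (cosh_sub1_ge0 (R := R)) (measurable_cosh_sub1 (R := R))
    Ca0 _ _ mA _)).
- by rewrite invr_ge0 ltW.
- by move=> x; exact: expR_ge0.
- move=> x y; set e := enorm y; have e0 : (0 <= e)%R by exact: enorm_ge0.
  rewrite ger0_norm// -/(h x); set s := (a^-1 * h x)%R.
  have s0 : (0 <= s)%R by rewrite mulr_ge0// invr_ge0 ltW.
  have t0 : (0 <= s / 2 * e)%R by rewrite mulr_ge0// divr_ge0.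
  rewrite (_ : (C * a)^-1 * _ = N^-1 * (s / 2 * e))%R; last first.
    have aux (p M u v : R) : (0 < p -> 0 < M -> 0 < a ->
        (p * M * a)^-1 * (p / 2 * (u * v)) = M^-1 * (a^-1 * u / 2 * v))%R.
      by move=> p0 M0 _; field; rewrite !gt_eqF.
    exact: aux.
  have N' : (0 <= N^-1 <= 1)%R by rewrite invr_ge0 ltW//= invf_le1.
  (* Convexity and the value 0 at 0 bring N^-1 out of the Young function. *)
  apply: (le_trans (supported_contract (supported_cosh_sub1 (R := R)) (cosh_sub1_0 (R := R)) N' t0)).
  rewrite [leRHS]mulrCA ler_wpM2l ?invr_ge0 ?(ltW N0)//.
  apply: (le_trans (cosh_sub1_le t0)); apply: (le_trans (expR_lin_gauss _ _)).
  rewrite ler_wpM2r ?expR_ge0// ler_expR; have := sqr_ge0 s; nra.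
rewrite KE -EFinM.
(* exp(s^2 / 2) is [gauss2] plus 1, and gamma has mass one, so the modular bound 1 becomes 2. *)
have le2 : \int[gam]_x (expR ((a^-1 * `|h x|) ^+ 2 / 2))%:E <= 2%:E.
  have -> : \int[gam]_x (expR ((a^-1 * `|h x|) ^+ 2 / 2))%:E =
      \int[gam]_x (gauss2 (a^-1 * `|h x|))%:E + 1.
    rewrite -(@probability_setT _ _ _ gam) -[X in _ + X]mul1e -integral_cst//.
    rewrite -ge0_integralD//=; last 2 first.
    - by move=> x _; rewrite lee_fin subr_ge0 -expR0 ler_expR divr_ge0 ?sqr_ge0.
    - by apply/measurable_EFinP; apply: measurable_funB.
    by apply: eq_integral => x _; rewrite /gauss2 -EFinD subrK.
  by rewrite (_ : 2%:E = 1 + 1)// leeD2r.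
apply: (@le_trans _ _ (2%:E * (N^-1 * K)%:E)).
  apply: lee_wpmul2r; last exact: le2.
  by rewrite lee_fin mulr_ge0// invr_ge0 ltW.
rewrite -EFinM lee_fin mulrCA mulrC ler_pdivrMr// mul1r /N; lra.
Qed.

Let c2 (q : R) : R := ((pi / 2) `^ q * expR (q ^+ 2) * K)%R.

(** Powers are multiplicative, so only |y|^q has to be absorbed: |y|^q <= exp(q |y|) <= exp(q^2)
    exp(|y|^2 / 4). The added 1 makes the constant positive. *)
Lemma Lnorm_poincare q : (1 < q)%R ->
  'N[gam]_q%:E [EFin \o g] <= ((1 + c2 q) `^ q^-1)%:E * 'N[gam]_q%:E [EFin \o h].
Proof.
move=> q1; have q0 : (0 < q)%R by lra.
have c20 : (0 <= c2 q)%R by rewrite !mulr_ge0 ?powR_ge0 ?expR_ge0.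
rewrite unlock; rewrite -[X in _ <= X * _]poweR_EFin -poweRM; last 2 first.
- by rewrite lee_fin addr_ge0.
- by apply: integral_ge0 => x _; exact: poweR_ge0.
have I0 (u : V -> R) : 0 <= \int[gam]_x (`|(EFin \o u) x| `^ q).
  by apply: integral_ge0 => x _; exact: poweR_ge0.
apply: gt0_ler_poweR.
- by rewrite invr_ge0 ltW.
- by rewrite in_itv/= I0 leey.
- by rewrite in_itv/= leey andbT; apply: mule_ge0; rewrite ?I0// lee_fin addr_ge0.
have mA : measurable_fun [set: V] (fun x => `|h x| `^ q)%R.
  have mhn : measurable_fun [set: V] (fun x => `|h x|)%R by exact: measurableT_comp.
  exact: (measurableT_comp (measurable_powR q) mhn).
have := @maurey_pisier_product R n f f_C1 (fun t => t `^ q)%R 1%R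
  ((pi / 2) `^ q * expR (q ^+ 2))%R (fun x => `|h x| `^ q)%R
  (supported_powR q1) (fun t => powR_ge0 t q) (measurable_powR _) ler01 _ _ mA _.
rewrite KE -EFinM muleC => H.
rewrite /=.
apply: (@le_trans _ _ ((c2 q)%:E * \int[gam]_x (`|h x| `^ q)%:E)); last first.
  apply: lee_wpmul2r; last by rewrite lee_fin lerDr.
  by apply: integral_ge0 => x _; rewrite lee_fin powR_ge0.
under eq_integral do rewrite -[X in (X `^ _)%R]mul1r.
apply: H.
- by rewrite mulr_ge0 ?powR_ge0 ?expR_ge0.
- by move=> x; exact: powR_ge0.
move=> x y; set e := enorm y; have e0 : (0 <= e)%R by exact: enorm_ge0.
have p2 : (0 <= pi / 2 :> R)%R by rewrite divr_ge0.
rewrite mul1r ger0_norm// -/(h x) [X in (X `^ _)%R]mulrCA.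
rewrite (@powRM _ (h x) _ q) ?(mulr_ge0 p2)// ler_wpM2l ?powR_ge0//.
rewrite (powRM q p2 e0) -[leRHS]mulrA ler_wpM2l ?powR_ge0//.
(* For e != 0 the power is exp(q ln e) and ln e <= e; for e = 0 it vanishes because q != 0. *)
apply: le_trans (expR_lin_gauss q e); rewrite /powR.
case: ifPn => [_|e_neq0]; first by rewrite (gt_eqF q0) expR_ge0.
rewrite ler_expR ler_wpM2l ?ltW//.
have := expR_ge1Dx (ln e); rewrite lnK ?posrE; first lra.
by rewrite lt_neqAle eq_sym e_neq0.
Qed.

End gaussian_poincare.

Theorem proposition3 (R : realType) (n : nat) (n_ge1 : (1 <= n)%N) :
  exists (C1 : R) (C2 : R -> R) (C3 : R),
    [/\ 0 < C1, forall p : R, 1 / 2 < p -> 0 < C2 p, 0 < C3 &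
      forall f : 'rV[R]_n -> R, C1poly f ->
        let g := fun x => f x - gauss_mean f in
        let h := fun x => enorm (grad f x) in
        [/\ (luxemburg_norm (gaussian R n) (@exp2_conj R) g
              <= C1%:E * luxemburg_norm (gaussian R n) (@exp2_conj R) h)%E,
            forall p : R, 1 / 2 < p ->
              ('N[gaussian R n]_(2 * p)%:E [EFin \o g]
                <= (C2 p)%:E * 'N[gaussian R n]_(2 * p)%:E [EFin \o h])%E &
            (luxemburg_norm (gaussian R n) (@cosh_sub1 R) g
              <= C3%:E * luxemburg_norm (gaussian R n) (@gauss2 R) h)%E]].
Proof.
have [K K0 KE] := @ex_gauss_exp_integral R n.
have pi0 : 0 < pi :> R by exact: pi_gt0.
(* The constants are left open and read off from the three inequalities by unification; K was
   obtained before f, so they do not depend on f. Their positivity is checked afterwards. *)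
do 3 eexists; split; last first.
  move=> f f_C1 g h; split.
  - exact: exp2_conj_poincare K0 KE f_C1.
  - move=> p p1; have q1 : 1 < 2 * p by lra.
    exact: (Lnorm_poincare K0 KE f_C1 q1).
  - exact: cosh_sub1_poincare K0 KE f_C1.
- by rewrite mulr_gt0// ltr_wpDr ?mulr_ge0.
- by move=> p _; rewrite powR_gt0// ltr_wpDr// !mulr_ge0 ?powR_ge0 ?expR_ge0.
- have p2 : 0 <= pi / 2 :> R by rewrite divr_ge0// ltW.
  apply: ltr_wpDr => //; apply: mulr_ge0 => //; apply: mulr_ge0 => //.
  by apply: addr_ge0 => //; apply: mulr_ge0 => //; exact: sqr_ge0.
Qed.
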